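(* Let $X$ be a pointed metric space. (i) $\tau_0$ is smaller than $\tau_\gamma$, and $\tau_\gamma$ is smaller than $\tau_{\mathrm{Lip}}$. (ii) $\tau_\gamma$ is the largest locally convex topology on $\mathrm{Lip}_0(X)$ which coincides with $\tau_0$ on each norm bounded subset of $\mathrm{Lip}_0(X)$. (iii) If $F$ is a locally convex space and $T\colon\mathrm{Lip}_0(X)\to F$ is linear, then $T$ is $\tau_\gamma$-continuous if and only if $T|_B$ is $\tau_0$-continuous for each norm bounded subset $B$ of $\mathrm{Lip}_0(X)$. (iv) A sequence in $\mathrm{Lip}_0(X)$ is $\tau_\gamma$-convergent to zero if and only if it is norm bounded and $\tau_0$-convergent to zero. (v) A subset of $\mathrm{Lip}_0(X)$ is $\tau_\gamma$-bounded if and only if it is norm bounded. (vi) A subset of $\mathrm{Lip}_0(X)$ is $\tau_\gamma$-compact (respectively precompact, relatively compact) if and only if it is norm bounded and $\tau_0$-compact (respectively precompact, relatively compact). (vii) $(\mathrm{Lip}_0(X),\tau_\gamma)$ is a complete semi-Montel space.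
   Context: $\mathbb{K}$ is $\mathbb{R}$ or $\mathbb{C}$. $(X,d)$ is a metric space with a distinguished base point $0$. $\mathrm{Lip}_0(X)$ is the Banach space of all Lipschitz functions $f\colon X\to\mathbb{K}$ with $f(0)=0$, with norm $\mathrm{Lip}(f)=\sup\{|f(x)-f(y)|/d(x,y)\colon x,y\in X,\ x\ne y\}$ and closed unit ball $B_{\mathrm{Lip}_0(X)}$. ''Norm bounded'' refers to the norm $\mathrm{Lip}$, and $\tau_{\mathrm{Lip}}$ is the norm topology. $\tau_0$ is the compact-open topology on $\mathrm{Lip}_0(X)$ (uniform convergence on compact subsets of $X$). ''Smaller''/''larger'' for topologies means coarser/finer (not necessarily strictly). $\tau_\gamma$ is the mixed topology $\gamma[\mathrm{Lip},\tau_0]$ on $\mathrm{Lip}_0(X)$: the locally convex topology having as a base of neighborhoods of zero the sets $\gamma(U)=\bigcup_{n=1}^\infty\left(U_1\cap B_{\mathrm{Lip}_0(X)}+U_2\cap 2B_{\mathrm{Lip}_0(X)}+\cdots+U_n\cap 2^{n-1}B_{\mathrm{Lip}_0(X)}\right)$, where $U=\{U_n\}$ ranges over sequences of convex balanced $\tau_0$-neighborhoods of zero. A locally convex space is semi-Montel if each of its bounded subsets is relatively compact. *)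

(* Defs.v *)
From HB Require Import structures.
From mathcomp Require Import all_boot all_order all_algebra complex.
From mathcomp Require Import all_classical all_reals all_analysis.

Set Implicit Arguments.
Unset Strict Implicit.
Unset Printing Implicit Defensive.

Import Order.TTheory GRing.Theory Num.Theory.
Import numFieldNormedType.Exports.

Local Open Scope classical_set_scope.
Local Open Scope ring_scope.

Inductive scalar_kind := RealScalars | ComplexScalars.

Definition scalars (R : realType) (k : scalar_kind) : numFieldType :=
  match k with RealScalars => R | ComplexScalars => R[i] end.

Section Scalars.
Context {R : realType} {k : scalar_kind}.
Local Notation K := (scalars R k).

(* The absolute value of a MathComp [numFieldType] takes its values in the
   field itself, e.g. in [R[i]]; [modulus] is the same absolute value seen as
   an element of [R], and [ofreal] is the inclusion of [R] in the scalars
   (see [ofreal_modulus]). *)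
Definition modulus : K -> R :=
  match k return scalars R k -> R with
  | RealScalars => fun z => `|z|
  | ComplexScalars => fun z => complex.Re `|z|
  end.

Definition ofreal : R -> K :=
  match k return R -> scalars R k with
  | RealScalars => fun r => r
  | ComplexScalars => fun r => real_complex R r
  end.

Lemma ofreal_modulus (z : K) : ofreal (modulus z) = `|z|.
Proof. by rewrite /ofreal /modulus; move: z; case: k. Qed.

Lemma ofrealD (a b : R) : ofreal (a + b) = ofreal a + ofreal b.
Proof. by rewrite /ofreal; case: k => //=; rewrite rmorphD. Qed.

Lemma ofrealM (a b : R) : ofreal (a * b) = ofreal a * ofreal b.
Proof. by rewrite /ofreal; case: k => //=; rewrite rmorphM. Qed.

Lemma ofreal0 : ofreal 0 = 0.
Proof. by rewrite /ofreal; case: k. Qed.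

Lemma ofreal1 : ofreal 1 = 1.
Proof. by rewrite /ofreal; case: k. Qed.

Lemma ofreal_nat n : ofreal n%:R = n%:R.
Proof.
by elim: n => [|n IH]; rewrite ?ofreal0// -natr1 ofrealD IH ofreal1 natr1.
Qed.

Lemma ler_ofreal (a b : R) : (ofreal a <= ofreal b) = (a <= b).
Proof. by rewrite /ofreal; case: k => //=; rewrite lecR. Qed.

Lemma ofreal_inj : injective ofreal.
Proof. by move=> a b ab; apply/le_anti; rewrite -!ler_ofreal ab lexx. Qed.

Lemma ltr_ofreal (a b : R) : (ofreal a < ofreal b) = (a < b).
Proof. by rewrite !lt_neqAle ler_ofreal (inj_eq ofreal_inj). Qed.

Lemma modulus_ge0 (z : K) : 0 <= modulus z.
Proof. by rewrite -ler_ofreal ofreal0 ofreal_modulus. Qed.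

Lemma modulus0 : modulus 0 = 0.
Proof. by apply: ofreal_inj; rewrite ofreal_modulus normr0 ofreal0. Qed.

Lemma modulus1 : modulus 1 = 1.
Proof. by apply: ofreal_inj; rewrite ofreal_modulus normr1 ofreal1. Qed.

Lemma modulusM (z w : K) : modulus (z * w) = modulus z * modulus w.
Proof. by apply: ofreal_inj; rewrite ofrealM !ofreal_modulus normrM. Qed.

Lemma ler_modulusD (z w : K) : modulus (z + w) <= modulus z + modulus w.
Proof. by rewrite -ler_ofreal ofrealD !ofreal_modulus ler_normD. Qed.

Lemma modulus_le (z : K) (r : R) : (modulus z <= r) = (`|z| <= ofreal r).
Proof. by rewrite -ofreal_modulus ler_ofreal. Qed.

Lemma modulus_lt (z : K) (r : R) : (modulus z < r) = (`|z| < ofreal r).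
Proof. by rewrite -ofreal_modulus ltr_ofreal. Qed.

Lemma modulus_le0 (z : K) : modulus z <= 0 -> z = 0.
Proof. by rewrite -ler_ofreal ofreal0 ofreal_modulus normr_le0 => /eqP. Qed.

End Scalars.

Section LipschitzFunctions.
Context {R : realType} (k : scalar_kind) {X : metricType R}.
Local Notation K := (scalars R k).

Definition lipschitz_fun (f : X -> K) : Prop :=
  exists M : R, forall x y, modulus (f x - f y) <= M * mdist x y.

(* The supremum of the empty set is 0, so [Lip] vanishes on a singleton. *)
Definition Lip (f : X -> K) : R :=
  sup [set modulus (f p.1 - f p.2) / mdist p.1 p.2 | p in [set p | p.1 != p.2]].

Variable x0 : X.

Definition is_lip0 : {pred X -> K} := mem [set f | lipschitz_fun f /\ f x0 = 0].

Record lip0 := MkLip0 { lip0_fun :> X -> K ; lip0P : lip0_fun \in is_lip0 }.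

HB.instance Definition _ := [isSub for lip0_fun].
HB.instance Definition _ := gen_eqMixin lip0.
HB.instance Definition _ := gen_choiceMixin lip0.

Lemma is_lip0_submod_closed : submod_closed is_lip0.
Proof.
split=> [|a f g].
  rewrite inE; split=> //; exists 0 => x y.
  by rewrite mul0r subrr modulus0.
rewrite !inE => -[[M fM] f0] [[N gN] g0]; split; last first.
  by rewrite (_ : (a *: f + g) x0 = a * f x0 + g x0)// f0 g0 mulr0 addr0.
exists (modulus a * M + N) => x y.
rewrite [X in modulus X](_ : _ = a * (f x - f y) + (g x - g y)); last first.
  by rewrite mulrBr addrACA -opprD.
rewrite (le_trans (ler_modulusD _ _))// modulusM mulrDl lerD//.
by rewrite -mulrA ler_wpM2l ?modulus_ge0.
Qed.

HB.instance Definition _ :=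
  GRing.isSubmodClosed.Build K (X -> K) is_lip0 is_lip0_submod_closed.
HB.instance Definition _ := [SubChoice_isSubLmodule of lip0 by <:].

Lemma lip0D (f g : lip0) x : (f + g) x = f x + g x.
Proof. by []. Qed.

Lemma lip0Z (a : K) (f : lip0) x : (a *: f) x = a * f x.
Proof. by []. Qed.

Lemma lip00 x : (0 : lip0) x = 0.
Proof. by []. Qed.

Lemma lip0_eqP (f g : lip0) : (forall x, f x = g x) -> f = g.
Proof. by move=> fg; apply/val_inj/funext. Qed.

Lemma lip0_base (f : lip0) : f x0 = 0.
Proof. by have := lip0P f; rewrite inE => -[]. Qed.

Lemma lip0_lipschitz (f : lip0) : lipschitz_fun f.
Proof. by have := lip0P f; rewrite inE => -[]. Qed.

Lemma Lip_ge0 (f : X -> K) : 0 <= Lip f.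
Proof.
rewrite /Lip; set S := (X in sup X); have [supS|] := pselect (has_sup S).
  have [r Sr] := supS.1; apply: (@le_trans _ _ r); last exact: sup_upper_bound.
  by case: Sr => -[x y] /= _ <-; rewrite divr_ge0 ?modulus_ge0// mdist_ge0.
by move=> /sup_out ->.
Qed.

Lemma Lip_le (f : X -> K) (M : R) : 0 <= M ->
  (forall x y, modulus (f x - f y) <= M * mdist x y) -> Lip f <= M.
Proof.
move=> M0 fM; rewrite /Lip; set S := (X in sup X).
have [->|/set0P S0] := eqVneq S set0; first by rewrite sup0.
apply: ge_sup => // _ [[x y] /= xy <-].
by rewrite ler_pdivrMr ?mdist_gt0.
Qed.

Lemma LipP (f : X -> K) : lipschitz_fun f ->
  forall x y, modulus (f x - f y) <= Lip f * mdist x y.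
Proof.
move=> [M fM] x y; have [->|xy] := eqVneq x y.
  by rewrite subrr modulus0 mulr_ge0// ?Lip_ge0// mdist_ge0.
rewrite -ler_pdivrMr ?mdist_gt0//; apply: ub_le_sup; last by exists (x, y).
exists M => _ [[x' y'] /= xy' <-].
by rewrite ler_pdivrMr ?mdist_gt0.
Qed.

Lemma Lip0 : Lip (0 : lip0) = 0.
Proof.
apply/le_anti; rewrite Lip_ge0 andbT; apply: Lip_le => // x y.
by rewrite !lip00 subrr modulus0 mul0r.
Qed.

Lemma LipD (f g : lip0) : Lip (f + g) <= Lip f + Lip g.
Proof.
apply: Lip_le; first by rewrite addr_ge0 ?Lip_ge0.
move=> x y; rewrite !lip0D opprD addrACA mulrDl.
by rewrite (le_trans (ler_modulusD _ _))// lerD// LipP//; apply: lip0_lipschitz.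
Qed.

Lemma LipZ (a : K) (f : lip0) : Lip (a *: f) = modulus a * Lip f.
Proof.
have H (b : K) (h : lip0) : Lip (b *: h) <= modulus b * Lip h.
  apply: Lip_le; first by rewrite mulr_ge0 ?Lip_ge0 ?modulus_ge0.
  move=> x y; rewrite !lip0Z -mulrBr modulusM -mulrA ler_wpM2l ?modulus_ge0//.
  exact/LipP/lip0_lipschitz.
apply/le_anti; rewrite H/=.
have [->|a0] := eqVneq a 0; first by rewrite modulus0 mul0r Lip_ge0.
have := H a^-1 (a *: f); rewrite scalerA mulVf// scale1r.
move=> /(ler_wpM2l (modulus_ge0 a)).
by rewrite mulrA -modulusM divff// modulus1 mul1r.
Qed.

Lemma Lip_eq0 (f : lip0) : Lip f = 0 -> f = 0.
Proof.
move=> f0; apply: lip0_eqP => x.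
have := LipP (lip0_lipschitz f) x x0; rewrite f0 mul0r lip0_base subr0.
by rewrite lip00 => /modulus_le0.
Qed.

End LipschitzFunctions.

Section NormAndCompactOpen.
Context {R : realType} (k : scalar_kind) {X : metricType R} (x0 : X).
Local Notation K := (scalars R k).
Local Notation L := (lip0 k x0).

(* [lip0] has only a linear structure; the convertible types [lip0_norm],
   [lip0_co] and [lip0_mixed] carry the norm, the compact-open and the mixed
   topology. *)
Definition lip0_norm : Type := L.

HB.instance Definition _ := GRing.Lmodule.copy lip0_norm L.

Let lip0_norm_fun (f : lip0_norm) : K := ofreal (Lip (f : L)).

Let lip0_normD (f g : lip0_norm) :
  lip0_norm_fun (f + g) <= lip0_norm_fun f + lip0_norm_fun g.
Proof. by rewrite -ofrealD ler_ofreal; exact: LipD. Qed.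

Let lip0_normZ (a : K) (f : lip0_norm) :
  lip0_norm_fun (a *: f) = `|a| * lip0_norm_fun f.
Proof. by rewrite -ofreal_modulus -ofrealM; congr ofreal; exact: LipZ. Qed.

Let lip0_norm_eq0 (f : lip0_norm) : lip0_norm_fun f = 0 -> f = 0.
Proof. by rewrite -ofreal0 => /ofreal_inj/Lip_eq0. Qed.

HB.instance Definition _ :=
  Lmodule_isNormed.Build K lip0_norm lip0_normD lip0_normZ lip0_norm_eq0.

Lemma lip0_normE (f : L) : `|(f : lip0_norm)| = ofreal (Lip f).
Proof. by []. Qed.

Definition lip0_co : Type :=
  initial_topology (fun f : L => (f : {family compact, X -> K})).

HB.instance Definition _ := GRing.Lmodule.copy lip0_co L.
HB.instance Definition _ := Uniform.copy lip0_co
  (initial_topology (fun f : L => (f : {family compact, X -> K}))).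

End NormAndCompactOpen.

Definition balanced {K : numFieldType} {E : lmodType K} (A : set E) : Prop :=
  forall (a : K) (v : E), `|a| <= 1 -> A v -> A (a *: v).

Section MixedTopology.
Context {R : realType} (k : scalar_kind) {X : metricType R} (x0 : X).
Local Notation K := (scalars R k).
Local Notation L := (lip0 k x0).
Local Notation Lco := (lip0_co k x0).

Definition lip0_ball (r : R) : set L := [set f | Lip f <= r].

Definition co_sequence (U : nat -> set L) : Prop :=
  forall n, [/\ nbhs (0 : Lco) (U n), convex_set (U n) & balanced (U n)].

(* [U i] stands for U_{i+1}, so that [2 ^+ i] is the factor 2^{(i+1)-1}. *)
Definition mixed_nbhd (U : nat -> set L) : set L :=
  \bigcup_n [set \sum_(i < n.+1) g i |
             g in [set g : nat -> L | forall i, (i <= n)%N ->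
               (U i `&` lip0_ball (2 ^+ i)) (g i)]].

Definition lip0_mixed : Type := L.

HB.instance Definition _ := GRing.Lmodule.copy lip0_mixed L.

Definition mixed_nbhs (f : lip0_mixed) : set_system lip0_mixed :=
  [set A | exists2 U, co_sequence U & forall g, mixed_nbhd U g -> A (f + g)].

HB.instance Definition _ := hasNbhs.Build lip0_mixed mixed_nbhs.

Lemma convex_setP (A : set L) : convex_set A <->
  forall (a b : K) f g, 0 <= a -> 0 <= b -> a + b = 1 -> A f -> A g ->
    A (a *: f + b *: g).
Proof.
split=> [cA a b f g a0 b0 ab Af Ag|cA f g l].
  have a1 : a <= 1 by rewrite -ab lerDl.
  have -> : b = 1 - a by rewrite -ab addrAC subrr add0r.
  by have := cA f g (Itv01 a0 a1); rewrite !inE; apply.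
rewrite !inE => Af Ag; apply: (cA l%:num (1 - l%:num)) => //.
by rewrite addrC subrK.
Qed.

Lemma co_nbhsP (A : set L) : nbhs (0 : Lco) A ->
  exists2 B : set {family compact, X -> K},
    nbhs ((0 : L) : {family compact, X -> K}) B & forall f : L, B f -> A f.
Proof.
by case=> _ [[B oB <-]] B0 BA; exists B => //; exact: open_nbhs_nbhs.
Qed.

Lemma co_nbhs_norm (A : set L) : nbhs (0 : Lco) A ->
  exists2 e : R, 0 < e & forall f : L, Lip f <= e -> A f.
Proof.
move=> /co_nbhsP[B B0 BA].
pose F : set_system (X -> K) :=
  [set C | exists2 e : R, 0 < e & forall f : L, Lip f <= e -> C f].
have FF : Filter F.
  split; first by exists 1.
  - move=> C D [d d0 dC] [e e0 eD]; exists (Num.min d e).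
      by rewrite lt_min d0.
    by move=> f; rewrite le_min => /andP[/dC ? /eD].
  - by move=> C D CD [e e0 eC]; exists e => // f /eC/CD.
suff : {family compact, F --> ((0 : L) : X -> K)}.
  by move=> /(_ B B0)[e e0 eB]; exists e => // f /eB/BA.
apply/fam_cvgP => C cptC D /uniform_nbhs[E [entE ED]].
have [d /= d0 dE] : exists2 d : K, 0 < d &
    forall z w : K, `|z - w| < d -> E (z, w).
  move: entE; rewrite -entourage_ballE => -[d d0 dE].
  by exists d => // z w zw; apply: dE.
have [M M0 CM] : exists2 M : R, 0 < M & forall x, C x -> mdist x x0 <= M.
  move/compact_near_coveringP : cptC.
  move=> /(_ R +oo%R (fun M x => mdist x x0 <= M) _)[].
    move=> x Cx; exists (ball x 1, [set M | mdist x x0 + 1 < M]).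
      split; first exact: nbhsx_ballx.
      by exists (mdist x x0 + 1); split => //; exact: num_real.
    move=> [y M] /= [+ /ltW xM]; rewrite ballEmdist /= => xy.
    rewrite (le_trans _ xM)// (le_trans (metric_triangle _ x _))//.
    by rewrite addrC lerD2l ltW// metric_sym.
  move=> M [_ MC]; exists (Num.max M 0 + 1).
    by rewrite ltr_wpDl// le_max lexx orbT.
  by apply: MC; rewrite (@le_lt_trans _ _ (Num.max M 0)) ?ltrDl// le_max lexx.
have md0 : 0 < modulus d.
  by rewrite -(@ltr_ofreal _ k) ofreal_modulus ofreal0 normr_gt0 gt_eqF.
exists (modulus d / 2 / M); first by rewrite !divr_gt0.
move=> f fd; apply: ED => y Cy; apply: dE; rewrite lip00 sub0r normrN.
rewrite -[ltRHS](gtr0_norm d0) -(ofreal_modulus d) -modulus_lt.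
apply: (@le_lt_trans _ _ (Lip f * M)).
  have := LipP (lip0_lipschitz f) y x0; rewrite lip0_base subr0.
  by move=> /le_trans; apply; rewrite ler_wpM2l ?Lip_ge0 ?CM.
apply: (@le_lt_trans _ _ (modulus d / 2)); first by rewrite -ler_pdivlMr.
by rewrite ltr_pdivrMr// ltr_pMr// ltr1n.
Qed.

Lemma co_nbhs_half (A : set L) : nbhs (0 : Lco) A ->
  nbhs (0 : Lco) [set f : L | A (f + f)].
Proof.
move=> /co_nbhsP[B B0 BA].
pose G : L -> {family compact, X -> K} := fun f => (f : X -> K).
have GB : nbhs (G 0) [set g | B (fun x => g x + g x)].
  have : {family compact, (fun g : X -> K => (fun x => g x + g x))
      @ nbhs (G 0) --> (G 0 : X -> K)}.
    apply/fam_cvgP => C cptC D /uniform_nbhs[E [entE ED]].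
    have [d /= d0 dE] : exists2 d : K, 0 < d &
        forall z w : K, `|z - w| < d -> E (z, w).
      move: entE; rewrite -entourage_ballE => -[d d0 dE].
      by exists d => // z w zw; apply: dE.
    have d20 : 0 < d / 2 by rewrite divr_gt0.
    have entd2 := entourage_ball K (PosNum d20).
    have := @fam_nbhs X K compact C _ (G 0) entd2 cptC.
    apply: filterS => g gd; apply: ED => y /gd.
    rewrite /ball/= !sub0r !normrN => gyd.
    apply: dE; rewrite sub0r normrN (le_lt_trans (ler_normD _ _))//.
    by rewrite (splitr d) ltrD.
  by move=> /(_ B B0).
have GB0 : nbhs (0 : Lco) [set f : L | B (fun x => G f x + G f x)].
  exact: (@initial_continuous _ _ G (0 : L) _ GB).
by apply: filterS GB0 => f; exact: (BA (f + f)).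
Qed.

Lemma lip0_ball0 n : lip0_ball (2 ^+ n) 0.
Proof. by change (Lip (0 : L) <= 2 ^+ n); rewrite Lip0 exprn_ge0. Qed.

Lemma mixed_nbhd0 U : co_sequence U -> mixed_nbhd U 0.
Proof.
move=> cU; exists 0%N => //; exists (fun=> 0); last by rewrite big1.
move=> i _; split; first by have [+ _ _] := cU i; apply: nbhs_singleton.
exact: lip0_ball0.
Qed.

Lemma co_sequenceI U V : co_sequence U -> co_sequence V ->
  co_sequence (fun n => U n `&` V n).
Proof.
move=> cU cV n; have [Un Uc Ub] := cU n; have [Vn Vc Vb] := cV n.
split; first exact: filterI.
- apply/convex_setP => a b f g a0 b0 ab [Uf Vf] [Ug Vg].
  by split; [move/convex_setP : Uc|move/convex_setP : Vc]; apply.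
- by move=> a f a1 [Uf Vf]; split; [exact: Ub|exact: Vb].
Qed.

Lemma mixed_nbhdS U V : (forall n, U n `<=` V n) ->
  mixed_nbhd U `<=` mixed_nbhd V.
Proof.
move=> UV _ [n _ [g gU <-]]; exists n => //; exists g => // i /gU[Ui Bi].
by split => //; exact: UV.
Qed.

Definition co_sequence_half (U : nat -> set L) : nat -> set L :=
  fun n => [set f | U n.+1 (f + f)].

Lemma co_sequence_halfP U : co_sequence U -> co_sequence (co_sequence_half U).
Proof.
move=> cU n; have [Un Uc Ub] := cU n.+1; split; first exact: co_nbhs_half.
- apply/convex_setP => a b f g a0 b0 ab Uf Ug.
  rewrite /co_sequence_half/= addrACA -!scalerDr.
  by move/convex_setP : Uc; apply.
- by move=> a f a1 Uf; rewrite /co_sequence_half/= -scalerDr; exact: Ub.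
Qed.

Lemma mixed_nbhd_pad U f : co_sequence U -> mixed_nbhd U f ->
  exists n, forall m, (n <= m)%N -> exists2 g : nat -> L,
    (forall i, (U i `&` lip0_ball (2 ^+ i)) (g i)) &
    f = \sum_(i < m) g i.
Proof.
move=> cU [n _ [g gU <-]]; exists n.+1 => m nm.
exists (fun i => if (i <= n)%N then g i else 0).
  move=> i; case: ifPn => [/gU//|_].
  split; first by have [+ _ _] := cU i; apply: nbhs_singleton.
  exact: lip0_ball0.
rewrite -(subnKC nm) big_split_ord/= [X in _ + X]big1 ?addr0.
  by apply: eq_bigr => i _; rewrite -ltnS ltn_ord.
by move=> i _; rewrite leqNgt ltnS leq_addr.
Qed.

Lemma mixed_nbhd_conv U : co_sequence U -> convex_set (mixed_nbhd U).
Proof.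
move=> cU; apply/convex_setP => a b f g a0 b0 ab.
move=> /(mixed_nbhd_pad cU)[n Hn] /(mixed_nbhd_pad cU)[m Hm].
have [u uU ->] := Hn (maxn n m).+1 (leqW (leq_maxl _ _)).
have [v vU ->] := Hm (maxn n m).+1 (leqW (leq_maxr _ _)).
exists (maxn n m) => //; exists (fun i => a *: u i + b *: v i); last first.
  by rewrite big_split/= !scaler_sumr.
move=> i _; have [Uu Bu] := uU i; have [Uv Bv] := vU i; split.
  by have [_ /convex_setP + _] := cU i; apply.
have mab : modulus a + modulus b = 1.
  apply: (@ofreal_inj _ k).
  by rewrite ofrealD !ofreal_modulus !ger0_norm// ofreal1.
rewrite /lip0_ball /mkset (le_trans (LipD _ _))// !LipZ.
by rewrite -[leRHS]mul1r -[X in _ <= X * _]mab mulrDl lerD ?ler_wpM2l ?modulus_ge0.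
Qed.

Lemma mixed_nbhd_half U f g : co_sequence U ->
  mixed_nbhd (co_sequence_half U) f -> mixed_nbhd (co_sequence_half U) g ->
  mixed_nbhd U (f + g).
Proof.
move=> cU; have cV := co_sequence_halfP cU.
move=> /(mixed_nbhd_pad cV)[n Hn] /(mixed_nbhd_pad cV)[m Hm].
have [u uU ->] := Hn _ (leq_maxl n m).
have [v vU ->] := Hm _ (leq_maxr n m).
exists (maxn n m) => //; exists (fun i => if i is j.+1 then u j + v j else 0).
  move=> [_|i _].
    split; first by have [+ _ _] := cU 0%N; apply: nbhs_singleton.
    exact: lip0_ball0.
  have [Uu Bu] := uU i; have [Uv Bv] := vU i; split.
    have [_ /convex_setP + _] := cU i.+1.
    have half w : w = 2^-1 *: (w + w) :> L.
      rewrite scalerDr -scalerDl -[_ + _]mulr2n -[_ *+ 2]mulr_natl.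
      by rewrite mulfV ?scale1r// pnatr_eq0.
    move=> Uconv; rewrite [u i]half [v i]half; apply: Uconv => //.
    by rewrite -[LHS]mulr2n -[LHS]mulr_natl mulfV// pnatr_eq0.
  rewrite /lip0_ball /mkset (le_trans (LipD _ _))//.
  by rewrite exprS mulr_natl mulr2n lerD.
by rewrite big_ord_recl/= add0r big_split.
Qed.

Lemma mixed_nbhd_bal U : co_sequence U -> balanced (mixed_nbhd U).
Proof.
move=> cU a _ a1 [n _ [g gU <-]]; exists n => //.
exists (fun i => a *: g i); last by rewrite scaler_sumr.
move=> i /gU[Ui Bi]; split; first by have [_ _] := cU i; apply.
rewrite /lip0_ball /mkset LipZ (le_trans _ Bi)// ler_piMl ?Lip_ge0//.
by rewrite modulus_le ofreal1.
Qed.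

Lemma mixed_nbhd_norm U : co_sequence U ->
  exists2 e : R, 0 < e & forall f : L, Lip f <= e -> mixed_nbhd U f.
Proof.
move=> cU; have [U0 _ _] := cU 0%N; have [e e0 eU] := co_nbhs_norm U0.
exists (Num.min e 1); first by rewrite lt_min e0 ltr01.
move=> f; rewrite le_min => /andP[fe f1].
exists 0%N => //; exists (fun=> f); last by rewrite big_ord_recl big_ord0 addr0.
by case=> // _; split; [exact: eU|rewrite /lip0_ball /mkset expr0].
Qed.

Fact mixed_nbhs_filter (f : lip0_mixed) : ProperFilter (nbhs f).
Proof.
apply: Build_ProperFilter_ex.
  by move=> A [U cU UA]; exists (f + 0); apply: UA; exact: mixed_nbhd0.
split.
- exists (fun=> setT) => // n; split; first exact: filterT.
  + by move=> *; rewrite in_setT.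
  + by [].
- move=> A B [U cU UA] [V cV VB]; exists (fun n => U n `&` V n).
    exact: co_sequenceI.
  by move=> g gUV; split; [apply: UA|apply: VB];
    apply: mixed_nbhdS gUV => n h [].
- by move=> A B AB [U cU UA]; exists U => // g /UA/AB.
Qed.

Fact mixed_nbhs_singleton (f : lip0_mixed) A : nbhs f A -> A f.
Proof.
by move=> [U cU UA]; rewrite -[f]addr0; apply: UA; exact: mixed_nbhd0.
Qed.

Fact mixed_nbhs_nbhs (f : lip0_mixed) A : nbhs f A -> nbhs f (nbhs^~ A).
Proof.
move=> [U cU UA]; have cV := co_sequence_halfP cU.
exists (co_sequence_half U) => // g gV; exists (co_sequence_half U) => // h hV.
by rewrite -addrA; apply: UA; exact: mixed_nbhd_half.
Qed.

HB.instance Definition _ := Nbhs_isNbhsTopological.Build lip0_mixed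
  mixed_nbhs_filter mixed_nbhs_singleton mixed_nbhs_nbhs.

Let mixed_add_continuous :
  continuous (fun x : lip0_mixed * lip0_mixed => x.1 + x.2).
Proof.
move=> [f g] A [U cU UA]; have cV := co_sequence_halfP cU.
exists ([set h | mixed_nbhd (co_sequence_half U) (h - f)],
        [set h | mixed_nbhd (co_sequence_half U) (h - g)]).
  split; exists (co_sequence_half U) => // h hV /=.
    by rewrite addrAC subrr add0r.
  by rewrite addrAC subrr add0r.
move=> [u v] [/= uf vg]; have := UA _ (mixed_nbhd_half cU uf vg).
by rewrite /= addrACA [f + _]addrC [g + _]addrC !subrK.
Qed.

Lemma mixed_nbhd_iter (n : nat) U : co_sequence U ->
  exists2 V, co_sequence V &
    forall f, mixed_nbhd V f -> mixed_nbhd U (2 ^+ n *: f).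
Proof.
elim: n U => [U cU|n IH U cU].
  by exists U => // f; rewrite expr0 scale1r.
have [V cV VU] := IH _ (co_sequence_halfP cU).
exists V => // f /VU fU; rewrite exprS mulr_natl mulr2n scalerDl.
exact: mixed_nbhd_half.
Qed.

Let mixed_scale_continuous :
  continuous (fun z : K^o * lip0_mixed => z.1 *: z.2).
Proof.
move=> [r f] A [U cU UA]; have cV := co_sequence_halfP cU.
have [e e0 eV] := mixed_nbhd_norm cV.
have [n rn] : exists n, `|r| + 1 <= 2 ^+ n :> K.
  exists (Num.truncn (modulus r + 1)).+1.
  have -> : `|r| + 1 = ofreal (modulus r + 1).
    by rewrite ofrealD ofreal1 ofreal_modulus.
  apply: (@le_trans _ _ (Num.truncn (modulus r + 1)).+1%:R); last first.
    by rewrite -natrX ler_nat ltnW// ltn_expl.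
  have -> : (Num.truncn (modulus r + 1)).+1%:R =
    ofreal ((Num.truncn (modulus r + 1)).+1%:R) :> K.
    by rewrite ofreal_nat.
  by rewrite ler_ofreal ltW// truncnS_gt.
have [W cW WV] := mixed_nbhd_iter n cV.
have f1 : 0 < Lip (f : L) + 1 by rewrite ltr_wpDl ?Lip_ge0.
pose d := Num.min 1 (e / (Lip (f : L) + 1)).
have d0 : 0 < d by rewrite lt_min ltr01 divr_gt0.
exists ([set s : K^o | modulus (s - r) < d], [set h | mixed_nbhd W (h - f)]).
  split.
    apply/nbhs_ballP; exists (ofreal d) => /=.
      by rewrite -ofreal0 ltr_ofreal.
    by move=> s; rewrite /ball/= distrC modulus_lt.
  by exists W => // h hW /=; rewrite addrAC subrr add0r.
move=> [s h] [/= + hf]; rewrite lt_min => /andP[sr1 srf].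
have -> : s *: h = r *: f + ((s - r) *: f + s *: (h - f)).
  by rewrite scalerBl scalerBr addrA [r *: f + _]addrC subrK addrC subrK.
apply: UA; apply: mixed_nbhd_half => //.
  apply: eV; rewrite LipZ (@le_trans _ _ (modulus (s - r) * (Lip (f : L) + 1)))//.
    by rewrite ler_wpM2l ?modulus_ge0// lerDl.
  by rewrite -ler_pdivlMr// ltW.
have -> : s *: (h - f) = (s / 2 ^+ n) *: (2 ^+ n *: (h - f)).
  by rewrite scalerA divfK// expf_neq0// pnatr_eq0.
apply: mixed_nbhd_bal => //; last exact: WV.
rewrite normrM normfV [X in _ / X]ger0_norm ?exprn_ge0//.
rewrite ler_pdivrMr ?exprn_gt0// mul1r (le_trans _ rn)//.
rewrite -[s](subrK r) addrC (le_trans (ler_normD _ _))// lerD2l.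
by rewrite -ofreal1 -modulus_le ltW.
Qed.

Let mixed_locally_convex : exists2 B : set_system lip0_mixed,
  (forall b, b \in B -> convex_set b) & basis B.
Proof.
exists [set b | open b /\ convex_set b].
  by move=> b; rewrite inE => -[].
split; first by move=> b [].
move=> f A [U cU UA].
pose C : set lip0_mixed := [set g | mixed_nbhd U (g - f)].
exists (C°); last first.
  move=> g /interior_subset; rewrite /C/= => /UA.
  by rewrite addrC subrK.
split; last by exists U => // g gU; rewrite /C/= addrAC subrr add0r.
split; first exact: open_interior.
apply/convex_setP => a b g h a0 b0 ab [V cV VC] [W cW WC].
exists (fun n => V n `&` W n); first exact: co_sequenceI.
move=> u uVW; have {}VC : C (g + u).
  by apply: VC; apply: mixed_nbhdS uVW => n v [].
have {}WC : C (h + u).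
  by apply: WC; apply: mixed_nbhdS uVW => n v [].
rewrite /C/=.
have -> : a *: g + b *: h + u - f = a *: (g + u - f) + b *: (h + u - f).
  rewrite -!(addrA _ u); move: (u - f) => w.
  by rewrite !scalerDr addrACA -scalerDl ab scale1r.
by have /convex_setP := mixed_nbhd_conv cU; apply.
Qed.

Lemma mixed_nbhs0P (A : set lip0_mixed) : nbhs (0 : lip0_mixed) A <->
  exists2 U, co_sequence U & mixed_nbhd U `<=` A.
Proof.
split=> -[U cU UA]; exists U => // g gU; last by rewrite add0r; exact: UA.
by rewrite -[g]add0r; exact: UA.
Qed.

(* [PreTopologicalLmod_isTvs] only builds the uniform structure, whose
   entourages are the sets containing [(f, g) | f - g \in V] for a
   neighborhood V of 0. *)
HB.instance Definition _ := PreTopologicalLmod_isTvs.Build K lip0_mixed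
  mixed_add_continuous mixed_scale_continuous mixed_locally_convex.
HB.instance Definition _ := PreTopologicalNmodule_isTopologicalNmodule.Build
  lip0_mixed mixed_add_continuous.
HB.instance Definition _ := TopologicalNmodule_isTopologicalLmodule.Build
  K lip0_mixed mixed_scale_continuous.
HB.instance Definition _ :=
  Uniform_isTvs.Build K lip0_mixed mixed_locally_convex.

End MixedTopology.

Section Topologies.
Context {K : numFieldType} {E : lmodType K}.

Definition coarser (sigma tau : Topological E) : Prop :=
  @open (Topological.Pack sigma) `<=` @open (Topological.Pack tau).

Definition coincide_on (sigma tau : Topological E) (B : set E) : Prop :=
  [set O `&` B | O in @open (Topological.Pack sigma)] =
  [set O `&` B | O in @open (Topological.Pack tau)].

(* The axioms of a [tvsType], for a topology that is not the canonical one. *)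
Definition locally_convex_topology (tau : Topological E) : Prop :=
  let T : topologicalType := Topological.Pack tau in
  [/\ continuous (fun p : T * T => ((p.1 : E) + (p.2 : E) : E) : T),
      continuous (fun p : K^o * T => (p.1 *: (p.2 : E) : E) : T) &
      exists2 B : set_system E, (forall b, b \in B -> convex_set b) &
        @basis T B].

End Topologies.

Definition bounded_in_tvs {K : numFieldType} {E : tvsType K} (A : set E) :=
  forall U : set E, nbhs 0 U ->
    exists2 r : K, 0 < r & forall a : K, r <= `|a| -> A `<=` [set a *: v | v in U].

(* Precompactness in the sense of the theory of locally convex spaces. The
   predicate [precompact] of MathComp-Analysis means relatively compact. *)
Definition totally_bounded {E : uniformType} (A : set E) :=
  forall V : set (E * E), entourage V ->
    exists2 F : set E, finite_set F & A `<=` \bigcup_(x in F) [set y | V (x, y)].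

Definition complete_space (E : uniformType) :=
  forall G : set_system E, ProperFilter G -> cauchy G -> exists l : E, G --> l.

Definition semi_Montel {K : numFieldType} (E : tvsType K) :=
  forall A : set E, bounded_in_tvs A -> precompact A.

Section LipTopologies.
Context {R : realType} (k : scalar_kind) {X : metricType R} (x0 : X).

Definition tau_Lip : Topological (lip0 k x0) :=
  Topological.class (lip0_norm k x0).

Definition tau_0 : Topological (lip0 k x0) := Topological.class (lip0_co k x0).

Definition tau_gamma : Topological (lip0 k x0) :=
  Topological.class (lip0_mixed k x0).

End LipTopologies.

(* Main.v *)
Require Import Defs.
From HB Require Import structures.
From mathcomp Require Import all_boot all_order all_algebra complex.
From mathcomp Require Import all_classical all_reals all_analysis.
From mathcomp Require Import ring lra.

Set Implicit Arguments.
Unset Strict Implicit.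
Unset Printing Implicit Defensive.

Import Order.TTheory GRing.Theory Num.Theory.
Import numFieldNormedType.Exports.

Local Open Scope classical_set_scope.
Local Open Scope ring_scope.

(** The mixed topology is determined by what the compact-open topology does on
    norm balls, and two lemmas make this usable.  A neighborhood of 0 for the
    mixed topology contains U_n inside the ball of radius 2^n, so it is a
    compact-open neighborhood of 0 relative to each norm ball
    ([mixed_nbhs_ball]).  Conversely, a convex set V whose homothetic copies
    2^-(n+1) V are compact-open neighborhoods of 0 relative to the balls of
    radius 2^n is a mixed neighborhood of 0 ([convex_mixed_nbhs]): with U_n
    inside 2^-(n+1) V on that ball, a sum of elements of the sets
    U_n `&` 2^n B is a subconvex combination of elements of V.  Parts (i), (ii)
    and (iii) follow, the hypotheses of (ii) and (iii) being exactly the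
    relative statement required of V.

    The remaining parts need to know that a set absorbed by the mixed
    neighborhoods of 0 is norm bounded ([absorbed_norm_bounded]).  Given pairs
    of distinct points x_n, y_n, the functions f with
    |f x_n - f y_n| <= 2^n d(x_n, y_n) for all n form a mixed neighborhood of 0
    ([slope_mixed_nbhs]): on a norm ball all but finitely many of the conditions
    hold automatically.  If slopes along the pairs (x_n, y_n) attained by
    members of a set exceed 4^n, this neighborhood does not absorb the set.
    Null sequences, compact sets and totally bounded sets of the mixed topology
    are absorbed, hence norm bounded, and on norm bounded sets the two
    topologies agree; this gives (iv), (v) and (vi).

    Norm balls are compact for the compact-open topology
    ([ball_co_compact], the relevant case of the Arzela-Ascoli theorem), so the
    mixed topology is semi-Montel by (v) and (vi).

    For completeness, a filter that is Cauchy for the mixed topology converges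
    uniformly on compact sets to a function h.  The neighborhoods of
    [slope_mixed_nbhs] show that h is Lipschitz, and convergence for the mixed
    topology follows because each mixed neighborhood of 0 contains the
    compact-open closure of another one ([mixed_nbhs_co_closed]). *)

(** * Scalars and their absolute value *)

Section ScalarTopology.
Context {R : realType} {k : scalar_kind}.
Local Notation K := (scalars R k).

Lemma modulusN (z : K) : modulus (- z) = modulus z.
Proof. by apply: (@ofreal_inj _ k); rewrite !ofreal_modulus normrN. Qed.

Lemma modulus_nat n : modulus (n%:R : K) = n%:R.
Proof.
by apply: (@ofreal_inj _ k); rewrite ofreal_modulus ofreal_nat normr_nat.
Qed.

Lemma modulus_exp2 n : modulus (2 ^+ n : K) = 2 ^+ n.
Proof. by rewrite -natrX modulus_nat natrX. Qed.

Lemma modulus_gt0 (z : K) : 0 < z -> 0 < modulus z.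
Proof.
by move=> z0; rewrite -(@ltr_ofreal _ k) ofreal0 ofreal_modulus normr_gt0 gt_eqF.
Qed.

Lemma modulusV (z : K) : modulus z^-1 = (modulus z)^-1.
Proof.
have [->|z0] := eqVneq z 0; first by rewrite invr0 modulus0 invr0.
have mz0 : modulus z != 0.
  by apply: contra_neq z0 => mz; apply: modulus_le0; rewrite mz.
by apply: (mulfI mz0); rewrite -modulusM !divff ?modulus1.
Qed.

Lemma modulus_convex (a b : K) : 0 <= a -> 0 <= b -> a + b = 1 ->
  modulus a + modulus b = 1.
Proof.
move=> a0 b0 ab; apply: (@ofreal_inj _ k).
by rewrite ofrealD !ofreal_modulus !ger0_norm// ofreal1.
Qed.

Lemma inv_exp2_le1 n : `|(2 ^+ n)^-1 : K| <= 1.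
Proof.
rewrite ger0_norm ?invr_ge0 ?exprn_ge0// invf_le1 ?exprn_gt0//.
by rewrite exprn_ege1// ler1n.
Qed.

Lemma scalar_entourageP (E : set (K * K)) : entourage E <->
  exists2 e : R, 0 < e & forall z w : K, modulus (z - w) < e -> E (z, w).
Proof.
rewrite -entourage_ballE; split=> [[d /= d0 dE]|[e e0 eE]].
  exists (modulus d); first exact: modulus_gt0.
  move=> z w; rewrite modulus_lt ofreal_modulus (gtr0_norm d0) => zw.
  exact: dE.
exists (ofreal e) => /=; first by rewrite -ofreal0 ltr_ofreal.
by move=> [z w]; rewrite /ball/= -modulus_lt; exact: eE.
Qed.

Lemma scalar_nbhsP (z : K) (A : set K) : nbhs z A <->
  exists2 e : R, 0 < e & forall w : K, modulus (z - w) < e -> A w.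
Proof.
rewrite -nbhs_entourageE; split.
  move=> [E /scalar_entourageP[e e0 eE] EA].
  by exists e => // w zw; apply/EA/xsectionP/eE.
move=> [e e0 eA]; exists [set zw | modulus (zw.1 - zw.2) < e].
  by apply/scalar_entourageP; exists e.
by move=> w /xsectionP; exact: eA.
Qed.

End ScalarTopology.

(** The image of an ultrafilter under a map that is not surjective still
    decides every set, so a cluster point of the image is a limit. *)
Lemma ultra_cvg_image {T : Type} {U : topologicalType} (F : set_system T)
    (f : T -> U) (C : set U) : UltraFilter F -> compact C ->
  F (f @^-1` C) -> exists2 z, C z & f @ F --> z.
Proof.
move=> FU cC FC; have [z [Cz Fz]] := cC (f @ F) _ FC.
exists z => // A Az; have [//|FA] := in_ultra_setVsetC (f @^-1` A) FU.
by have [w []] := Fz (~` A) A FA Az.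
Qed.

(** In the complex case the real and imaginary parts of an ultrafilter on the
    disc converge separately in a segment. *)
Lemma closed_disc_compact {R : realType} {k : scalar_kind} (r : R) :
  compact [set z : scalars R k | modulus z <= r].
Proof.
case: k.
  suff -> : [set z : scalars R RealScalars | modulus z <= r] = `[- r, r]%classic.
    exact: segment_compact.
  by apply/seteqP; split=> z /=; rewrite in_itv/= ler_norml.
rewrite compact_ultra => F FU Fr.
have Re_le (z : R[i]) : `|complex.Re z| <= @modulus R ComplexScalars z.
  by rewrite -lecR /= (normc_ge_Re z).
have Im_le (z : R[i]) : `|complex.Im z| <= @modulus R ComplexScalars z.
  rewrite /modulus normc_def /= -sqrtr_sqr ler_wsqrtr// lerDr sqr_ge0//.
have FRe : F ((fun z : R[i] => complex.Re z) @^-1` `[- r, r]%classic).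
  apply: filterS Fr => z /= zr.
  by rewrite in_itv/= -ler_norml (le_trans (Re_le z)).
have FIm : F ((fun z : R[i] => complex.Im z) @^-1` `[- r, r]%classic).
  apply: filterS Fr => z /= zr.
  by rewrite in_itv/= -ler_norml (le_trans (Im_le z)).
have [a _ Fa] := ultra_cvg_image FU (@segment_compact R _ _) FRe.
have [b _ Fb] := ultra_cvg_image FU (@segment_compact R _ _) FIm.
pose w : scalars R ComplexScalars := Complex a b.
have Fw : F --> w.
  move=> A /scalar_nbhsP[e e0 eA].
  have e20 : 0 < e / 2 by rewrite divr_gt0.
  have /Fa : nbhs a (ball a (e / 2)) by exact: nbhsx_ballx.
  have /Fb : nbhs b (ball b (e / 2)) by exact: nbhsx_ballx.
  move=> FB FA; apply: filterS (@filterI _ F _ _ _ FA FB) => z [].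
  rewrite /ball/= => za zb; apply: eA.
  pose im : scalars R ComplexScalars := Complex 0 1.
  have -> : w - z = ofreal (a - complex.Re z) + im * ofreal (b - complex.Im z).
    by rewrite /w /im; case: z {za zb} => c d; simpc.
  rewrite (le_lt_trans (ler_modulusD _ _))// [ltRHS]splitr.
  have modC (c : R) : modulus (ofreal c : scalars R ComplexScalars) = `|c|.
    by rewrite /modulus /ofreal normc_def /= expr0n addr0 sqrtr_sqr.
  apply: ltrD; first by rewrite modC.
  rewrite modulusM modC (_ : modulus _ = 1) ?mul1r//.
  by rewrite /modulus normc_def /= expr0n expr1n add0r sqrtr1.
exists w; split => //=; apply/ler_addgt0Pr => e e0.
have [z [wz /= zr]] : exists z, modulus (w - z) < e /\ modulus z <= r.
  apply: (@filter_ex _ F); apply: filterI => //; apply: Fw.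
  by apply/scalar_nbhsP; exists e.
suff : modulus w <= r + e by [].
rewrite -[w](subrK z) addrC (le_trans (ler_modulusD _ _))//.
by rewrite lerD// ltW.
Qed.

(** * The compact-open topology *)

Section CompactOpen.
Context {R : realType} {k : scalar_kind} {X : metricType R} {x0 : X}.
Local Notation K := (scalars R k).
Local Notation L := (lip0 k x0).
Local Notation Lco := (lip0_co k x0).

Definition co_disk (C : set X) (e : R) : set L :=
  [set f | forall x, C x -> modulus (f x) < e].

(** A finite union of compact sets is compact, so the finite intersections that
    generate the uniform structure reduce to one compact set and one radius. *)
Lemma co_entourageP (E : set (Lco * Lco)) : entourage E <->
  exists C (e : R), [/\ compact C, 0 < e &
    forall f g : L, co_disk C e (f - g) -> E (f, g)].
Proof.
pose Phi : set_system ({family compact, X -> K} * {family compact, X -> K}) :=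
  [set B | exists C (e : R), [/\ @compact X C, 0 < e &
    forall f g : X -> K, (forall x, C x -> modulus (f x - g x) < e) -> B (f, g)]].
have FPhi : Filter Phi.
  split.
  - by exists set0, 1; split => //; exact: compact0.
  - move=> P Q [C [d [cC d0 dP]]] [D [e [cD e0 eQ]]].
    exists (C `|` D), (Num.min d e); split; first exact: compactU.
      by rewrite lt_min d0.
    move=> f g fg; split; [apply: dP|apply: eQ] => x Cx.
      by have := fg x (or_introl Cx); rewrite lt_min => /andP[].
    by have := fg x (or_intror Cx); rewrite lt_min => /andP[].
  - by move=> P Q PQ [C [e [cC e0 eP]]]; exists C, e; split=> // f g /eP/PQ.
have PhiE (B : set ({family compact, X -> K} * {family compact, X -> K})) :
    entourage B <-> Phi B.
  split=> [[_ [F _ <-] FB]|[C [e [cC e0 eB]]]].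
    apply: filterS FB _; apply: filter_bigI => -[[[C cC] P] /= PE] _ /=.
    move: PE => /asboolP /=; rewrite uniform_entourage.
    move=> [Q /scalar_entourageP[e e0 eQ] QP]; exists C, e; split => // f g fg.
    by apply: QP => x Cx /=; apply: eQ; exact: fg.
  pose P := [set fg : (X -> K) * (X -> K) |
     forall x, C x -> modulus (fg.1 x - fg.2 x) < e].
  have entP : @entourage {uniform` C -> K} P.
    rewrite uniform_entourage; exists [set zw | modulus (zw.1 - zw.2) < e] => //.
    by apply/scalar_entourageP; exists e.
  exists P; last by case=> f g; exact: eB.
  unshelve eexists (finmap.fset1 _) => //.
    exact: (exist _ (existT _ C cC, P) (asboolT entP)).
    by move=> ? _; rewrite inE.
  by rewrite set_fset1 bigcap_set1.
split=> [[B /PhiE[C [e [cC e0 eB]]] BE]|[C [e [cC e0 eE]]]].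
  by exists C, e; split => // f g fg; apply: BE; exact: eB.
exists [set fg | forall x, C x -> modulus (fg.1 x - fg.2 x) < e].
  by apply/PhiE; exists C, e.
by move=> [f g] fg; exact: eE.
Qed.

Lemma co_nbhsE (f : L) (A : set L) : nbhs (f : Lco) A <->
  exists C (e : R),
    [/\ compact C, 0 < e & forall g : L, co_disk C e (g - f) -> A g].
Proof.
have symd C e (g h : L) : co_disk C e (g - h) -> co_disk C e (h - g).
  by move=> gh x /gh; rewrite -modulusN => /le_lt_trans; apply; rewrite -opprB.
rewrite -nbhs_entourageE; split.
  move=> [E /co_entourageP[C [e [cC e0 eE]]] EA]; exists C, e; split=> // g.
  by move=> /symd gf; apply/EA/xsectionP/eE.
move=> [C [e [cC e0 eA]]]; exists [set fg | co_disk C e (fg.1 - fg.2)].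
  by apply/co_entourageP; exists C, e.
by move=> g /xsectionP/symd; exact: eA.
Qed.

End CompactOpen.

(** * Neighborhoods of zero for the three topologies *)

Lemma exp2_bound {R : realType} (r : R) : exists n : nat, r <= 2 ^+ n.
Proof.
exists (Num.truncn r).+1; rewrite (@le_trans _ _ (Num.truncn r).+1%:R)//.
  by rewrite ltW// truncnS_gt.
by rewrite -natrX ler_nat ltnW// ltn_expl.
Qed.

Section MixedNeighborhoods.
Context {R : realType} {k : scalar_kind} {X : metricType R} {x0 : X}.
Local Notation K := (scalars R k).
Local Notation L := (lip0 k x0).
Local Notation Lco := (lip0_co k x0).
Local Notation Lmixed := (lip0_mixed k x0).

Lemma co_nbhs_shift (f : L) (A : set L) :
  nbhs (f : Lco) A <-> nbhs (0 : Lco) [set g : L | A (f + g)].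
Proof.
split=> /co_nbhsE[C [e [cC e0 eA]]]; apply/co_nbhsE; exists C, e; split => // g.
  by rewrite subr0 => ge; apply: eA; rewrite addrAC subrr add0r.
move=> ge; rewrite -[g](subrK f) addrC; apply: eA.
by rewrite subr0.
Qed.

Lemma mixed_nbhs_shift (f : L) (A : set L) :
  nbhs (f : Lmixed) A <-> nbhs (0 : Lmixed) [set g : L | A (f + g)].
Proof.
split=> -[U cU UA]; exists U => // g gU.
  by rewrite /mkset add0r; exact: UA.
by have := UA g gU; rewrite /mkset add0r.
Qed.

Lemma norm_nbhsE (f : L) (A : set L) : nbhs (f : lip0_norm k x0) A <->
  exists2 e : R, 0 < e & forall g : L, Lip (g - f) <= e -> A g.
Proof.
rewrite nbhs_ballP; split=> [[d /= d0 dA]|[e e0 eA]].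
  have md0 := modulus_gt0 d0.
  exists (modulus d / 2); first by rewrite divr_gt0.
  move=> g gd; apply: dA; rewrite -ball_normE /= distrC lip0_normE.
  rewrite -[ltRHS](gtr0_norm d0) -ofreal_modulus ltr_ofreal.
  by rewrite (le_lt_trans gd)// ltr_pdivrMr// ltr_pMr// ltr1n.
exists (ofreal e) => /=; first by rewrite -ofreal0 ltr_ofreal.
move=> g; rewrite -ball_normE /= distrC lip0_normE ltr_ofreal => ge.
by apply: eA; exact: ltW.
Qed.

(** Norm boundedness with a real bound: the norm of the normed module takes its
    values in the scalars, possibly complex ones. *)
Definition lip_bounded (A : set L) : Prop :=
  exists r : R, forall f, A f -> Lip f <= r.

Lemma norm_boundedP (A : set L) :
  bounded_set (A : set (lip0_norm k x0)) <-> lip_bounded A.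
Proof.
split=> [[M [Mreal MA]]|[r rA]].
  exists (modulus M + 1) => f Af.
  rewrite -(@ler_ofreal _ k); apply: MA Af => //.
  rewrite ofrealD ofreal1 ofreal_modulus (le_lt_trans (real_ler_norm Mreal))//.
  by rewrite ltrDl.
exists (ofreal `|r|); split.
  by apply: ger0_real; rewrite -ofreal0 ler_ofreal.
move=> M rM f Af /=; rewrite lip0_normE (le_trans _ (ltW rM))// ler_ofreal.
by rewrite (le_trans (rA f Af))// ler_norm.
Qed.

Lemma co_diskZ C e (a : K) (f : L) :
  co_disk C e f -> modulus a <= 1 -> co_disk C e (a *: f).
Proof.
move=> fe a1 x Cx; rewrite lip0Z modulusM (le_lt_trans _ (fe x Cx))//.
by rewrite ler_piMl ?modulus_ge0.
Qed.

Lemma co_disk_nbhs C (e : R) : compact C -> 0 < e ->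
  nbhs (0 : Lco) (co_disk C e : set L).
Proof.
by move=> cC e0; apply/co_nbhsE; exists C, e; split=> // g; rewrite subr0.
Qed.

Lemma co_disk_convex C (e : R) : convex_set (co_disk C e : set L).
Proof.
apply/convex_setP => a b f g a0 b0 ab fe ge x Cx.
have mab := modulus_convex a0 b0 ab.
rewrite lip0D !lip0Z (le_lt_trans (ler_modulusD _ _))// !modulusM.
have ha := modulus_ge0 a; have hb := modulus_ge0 b.
have hf := fe x Cx; have hg := ge x Cx.
have [h|h] := leP (modulus (f x)) (modulus (g x)).
  rewrite (le_lt_trans _ hg)// -[leRHS]mul1r -mab mulrDl lerD2r.
  by rewrite ler_wpM2l.
rewrite (le_lt_trans _ hf)// -[leRHS]mul1r -[X in _ <= X * _]mab mulrDl lerD2l.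
by rewrite ler_wpM2l// ltW.
Qed.

Lemma co_disk_balanced C (e : R) : balanced (co_disk C e : set L).
Proof. by move=> a f a1 /co_diskZ; apply; rewrite modulus_le ofreal1. Qed.

Lemma co_nbhs_scale (a : K) (A : set L) : nbhs (0 : Lco) A ->
  nbhs (0 : Lco) [set f : L | A (a *: f)].
Proof.
move=> /co_nbhsE[C [e [cC e0 eA]]]; apply/co_nbhsE.
have a1 : 0 < modulus a + 1 by rewrite ltr_wpDl ?modulus_ge0.
exists C, (e / (modulus a + 1)); split => //; first by rewrite divr_gt0.
move=> g; rewrite subr0 => ge; apply: eA; rewrite subr0 => x Cx.
rewrite lip0Z modulusM (@le_lt_trans _ _ ((modulus a + 1) * modulus (g x)))//.
  by rewrite ler_wpM2r ?modulus_ge0// lerDl.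
by rewrite mulrC -ltr_pdivlMr//; exact: ge.
Qed.

(** The weights 2^-(i+1) have sum less than 1, and the missing weight goes
    to 0. *)
Lemma convex_sum_halves (V : set L) (v : nat -> L) n : convex_set V -> V 0 ->
  (forall i, (i < n)%N -> V ((2 ^+ i.+1 : K) *: v i)) -> V (\sum_(i < n) v i).
Proof.
move=> /convex_setP cV V0; elim: n v => [|n IH] v vV; first by rewrite big_ord0.
have half (w : L) : w = 2^-1 *: (2 *: w).
  by rewrite scalerA mulVf ?scale1r// pnatr_eq0.
rewrite big_ord_recl [_ + _]half scalerDr scalerDr; apply: cV => //.
- by rewrite -[LHS]mulr2n -[LHS]mulr_natl mulfV// pnatr_eq0.
- by rewrite -[2]expr1; exact: vV.
- rewrite scaler_sumr; apply: (IH (fun i => 2 *: v i.+1)) => i ni.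
  by rewrite scalerA -exprSr; exact: vV.
Qed.

(** The criterion for being a mixed neighborhood of 0.  The factor 2^(n+1) makes
    the n-th summand of an element of the basic neighborhood 2^-(n+1) times an
    element of [V]. *)
Lemma convex_mixed_nbhs (V : set L) : convex_set V ->
  (forall n, nbhs (0 : Lco)
    [set f : L | Lip f <= 2 ^+ n -> V ((2 ^+ n.+1 : K) *: f)]) ->
  nbhs (0 : Lmixed) V.
Proof.
move=> cV VW.
have V0 : V 0.
  have := nbhs_singleton (VW 0%N) => /=; rewrite scaler0; apply.
  by rewrite Lip0.
have /choice[Ce CeP] : forall n, exists Ce : set X * R,
    [/\ compact Ce.1, 0 < Ce.2 & forall f : L, co_disk Ce.1 Ce.2 f ->
      Lip f <= 2 ^+ n -> V ((2 ^+ n.+1 : K) *: f)].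
  move=> n; have /co_nbhsE[C [e [cC e0 eV]]] := VW n.
  exists (C, e); split => // f fe.
  by apply: eV; rewrite subr0.
apply/mixed_nbhs0P; exists (fun n => co_disk (Ce n).1 (Ce n).2).
  move=> n; have [cC e0 _] := CeP n; split; first exact: co_disk_nbhs.
    exact: co_disk_convex.
  exact: co_disk_balanced.
move=> _ [n _ [g gU <-]]; apply: (@convex_sum_halves V g) => // i ni.
by have [_ _] := CeP i; apply; have [] := gU i ni.
Qed.

Lemma mixed_nbhd_single (U : nat -> set L) n (f : L) : co_sequence U ->
  U n f -> Lip f <= 2 ^+ n -> mixed_nbhd U f.
Proof.
move=> cU Unf fn; exists n => //.
exists (fun i => if i == n then f else 0) => [i _|]; last first.
  by rewrite -big_mkcond/= (big_pred1 ord_max).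
case: eqP => [->|_]; first by split.
by split; [have [+ _ _] := cU i; exact: nbhs_singleton|exact: lip0_ball0].
Qed.

(** Together with [convex_mixed_nbhs], the reason why the mixed topology only
    depends on the compact-open topology of norm balls. *)
Lemma mixed_nbhs_ball (A : set L) (r : R) : nbhs (0 : Lmixed) A ->
  nbhs (0 : Lco) [set f : L | Lip f <= r -> A f].
Proof.
move=> /mixed_nbhs0P[U cU UA]; have [n rn] := exp2_bound r.
have [Un _ _] := cU n; apply: filterS Un => f Unf fr; apply: UA.
exact: mixed_nbhd_single cU Unf (le_trans fr rn).
Qed.

Lemma co_nbhs_mixed (A : set L) : nbhs (0 : Lco) A -> nbhs (0 : Lmixed) A.
Proof.
move=> /co_nbhsE[C [e [cC e0 eA]]].
have VW n : nbhs (0 : Lco)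
    [set f : L | Lip f <= 2 ^+ n -> co_disk C e ((2 ^+ n.+1 : K) *: f)].
  have scaled := co_nbhs_scale (2 ^+ n.+1) (co_disk_nbhs cC e0).
  by apply: filterS scaled => f; rewrite /mkset.
have := convex_mixed_nbhs (@co_disk_convex C e) VW.
by apply: filterS => f fe; apply: eA; rewrite subr0.
Qed.

End MixedNeighborhoods.

(** * Sets absorbed by the mixed neighborhoods of zero *)

Section Bounded.
Context {R : realType} {k : scalar_kind} {X : metricType R} {x0 : X}.
Local Notation K := (scalars R k).
Local Notation L := (lip0 k x0).
Local Notation Lco := (lip0_co k x0).
Local Notation Lmixed := (lip0_mixed k x0).

Lemma co_nbhs_slope (x y : X) (d : R) : 0 < d ->
  nbhs (0 : Lco) [set f : L | modulus (f x - f y) <= d].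
Proof.
move=> d0; apply/co_nbhsE; exists [set x; y], (d / 2); split.
- exact: finite_compact.
- by rewrite divr_gt0.
- move=> g; rewrite subr0 => gd /=.
  rewrite (le_trans (ler_modulusD _ _))// modulusN [leRHS]splitr lerD// ltW//.
    by apply: gd; left.
  by apply: gd; right.
Qed.

(** A substitute for duality: the divided differences along the pairs
    (x n, y n) are functionals of norm at most 1, so on a norm ball the bounds
    2^n make all but finitely many conditions vacuous, and each of the others
    involves the values at two points only.  Since 2^n is unbounded, n-th slopes
    of order 4^n are not absorbed. *)
Lemma slope_mixed_nbhs (x y : nat -> X) : (forall n, x n != y n) ->
  nbhs (0 : Lmixed) [set f : L | forall n,
    modulus (f (x n) - f (y n)) <= 2 ^+ n * mdist (x n) (y n)].
Proof.
move=> xy; apply: convex_mixed_nbhs.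
  apply/convex_setP => a b f g a0 b0 ab fV gV n.
  have mab := modulus_convex a0 b0 ab.
  rewrite !lip0D !lip0Z opprD addrACA -!mulrBr.
  rewrite (le_trans (ler_modulusD _ _))// !modulusM.
  rewrite -[leRHS]mul1r -[X in _ <= X * _]mab mulrDl.
  by rewrite lerD ?ler_wpM2l ?modulus_ge0 ?fV ?gV.
move=> m.
suff : nbhs (0 : Lco) [set f : L | forall n, (n < m.*2.+1)%N ->
    modulus (((2 ^+ m.+1 : K) *: f) (x n) - ((2 ^+ m.+1 : K) *: f) (y n)) <=
      2 ^+ n * mdist (x n) (y n)].
  apply: filterS => f fV fm n; have [|mn] := ltnP n m.*2.+1; first exact: fV.
  rewrite (le_trans (LipP (lip0_lipschitz _) _ _))// ler_wpM2r ?mdist_ge0//.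
  rewrite LipZ modulus_exp2.
  (* the slopes are at most 2^(m+1) 2^m = 2^(2m+1), whence the range of n *)
  apply: (@le_trans _ _ (2 ^+ m.+1 * 2 ^+ m)); first by rewrite ler_wpM2l.
  by rewrite -exprD ler_weXn2l ?ler1n// addSn addnn.
elim: (m.*2.+1) => [|N IH]; first exact: filterS filterT.
have xyN : 0 < 2 ^+ N * mdist (x N) (y N) by rewrite mulr_gt0 ?mdist_gt0.
have := co_nbhs_scale (2 ^+ m.+1) (co_nbhs_slope (x N) (y N) xyN).
apply: filterS2 IH => f IH fN n.
by rewrite ltnS leq_eqVlt => /predU1P[->|]; [exact: fN|exact: IH].
Qed.

Lemma norm_absorbed (V : set L) (r : R) : nbhs (0 : Lmixed) V ->
  exists n, forall f : L, Lip f <= r -> forall a : K, 2 ^+ n <= modulus a ->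
    V (a^-1 *: f).
Proof.
move=> /mixed_nbhs0P[U /mixed_nbhd_norm[e e0 eU] UV].
have [n rn] := exp2_bound (r / e); exists n => f fr a na.
have a0 : 0 < modulus a by apply: lt_le_trans na; rewrite exprn_gt0.
apply/UV/eU; rewrite LipZ modulusV mulrC ler_pdivrMr// (le_trans fr)//.
by rewrite mulrC -ler_pdivrMr// (le_trans rn).
Qed.

Definition absorbed (A : set L) := forall V : set L, nbhs (0 : Lmixed) V ->
  exists n, forall f, A f -> V (((2 ^+ n)^-1 : K) *: f).

(** Slopes larger than 4^n, attained by members of an unbounded set, are not
    absorbed by the neighborhood of [slope_mixed_nbhs]: dilating it by 2^n only
    allows slopes up to 2^n 2^n along the n-th pair. *)
Lemma absorbed_norm_bounded (A : set L) : absorbed A -> lip_bounded A.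
Proof.
move=> absA; apply: contrapT => /forallNP unbounded.
have /choice[p pP] : forall n, exists p : L * (X * X),
    [/\ A p.1, p.2.1 != p.2.2 &
    4 ^+ n * mdist p.2.1 p.2.2 < modulus (p.1 p.2.1 - p.1 p.2.2)].
  move=> n; have /existsNP[f /not_implyP[Af /negP fn]] := unbounded (4 ^+ n).
  apply: contrapT => /forallNP noslope; move: fn; apply/negP; rewrite negbK.
  apply: Lip_le; first by rewrite exprn_ge0.
  move=> x y; have [->|xy] := eqVneq x y.
    by rewrite subrr modulus0 mulr_ge0 ?mdist_ge0// exprn_ge0.
  by rewrite leNgt; apply/negP => h; apply: (noslope (f, (x, y))).
have xy n : (p n).2.1 != (p n).2.2 by have [] := pP n.
have [n nV] := absA _ (slope_mixed_nbhs xy).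
have [Ap _] := pP n; apply/negP; rewrite -leNgt.
have := nV _ Ap n; rewrite !lip0Z -mulrBr modulusM modulusV modulus_exp2.
rewrite mulrC ler_pdivrMr ?exprn_gt0// => /le_trans; apply.
by rewrite mulrAC -exprMn -natrM.
Qed.

Lemma mixed_nbhs_halfP (V : set L) : nbhs (0 : Lmixed) V ->
  exists W : set L, [/\ nbhs (0 : Lmixed) W, balanced W &
    forall f g, W f -> W g -> V (f + g)].
Proof.
move=> /mixed_nbhs0P[U cU UV]; have cV := co_sequence_halfP cU.
exists (mixed_nbhd (co_sequence_half U)); split; last 1 first.
- by move=> f g fW gW; apply: UV; exact: mixed_nbhd_half.
- by apply/mixed_nbhs0P; exists (co_sequence_half U).
- exact: mixed_nbhd_bal.
Qed.

Lemma finite_norm_bounded (F : set L) : finite_set F -> lip_bounded F.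
Proof.
move=> /finite_seqP[s ->]; elim: s => [|f s [r rs]]; first by exists 0.
exists (Num.max (Lip f) r) => g /=; rewrite inE le_max => /predU1P[->|/rs ->].
  by rewrite lexx.
by rewrite orbT.
Qed.

Lemma mixed_totally_bounded_absorbed (A : set L) :
  totally_bounded (A : set Lmixed) -> absorbed A.
Proof.
move=> tbA V /mixed_nbhs_halfP[W [W0 balW WV]].
have entW : entourage [set fg : Lmixed * Lmixed | W (fg.1 - fg.2)].
  by exists W; split=> // fg; rewrite !inE.
have [F finF AF] := tbA _ entW.
have [r Fr] := finite_norm_bounded finF.
have [n nW] := norm_absorbed r W0; exists n => f /AF[g Fg /= gf].
rewrite -[f](subKr g) scalerBr -scaleNr; apply: WV.
  by apply: nW; [exact: Fr|rewrite modulus_exp2].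
by apply: balW => //; rewrite normrN inv_exp2_le1.
Qed.

(** Near each point f the n-th dilation works for all large n: f itself is
    absorbed and the deviation from f lies in a balanced neighborhood.
    Compactness makes the choice of n uniform. *)
Lemma mixed_compact_absorbed (A : set L) :
  compact (A : set Lmixed) -> absorbed A.
Proof.
move=> /compact_near_coveringP cA V /mixed_nbhs_halfP[W [W0 balW WV]].
pose P n (f : Lmixed) := V (((2 ^+ n)^-1 : K) *: (f : L)).
have [] := cA nat \oo P _.
  move=> f _; have [n nW] := norm_absorbed (Lip (f : L)) W0.
  exists ([set g : Lmixed | W ((g : L) - f)], [set m | (n <= m)%N]).
    split; last by exists n.
    apply/mixed_nbhs_shift; apply: filterS W0 => g Wg.
    by change (W ((f : L) + g - (f : L))); rewrite addrAC subrr add0r.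
  move=> [g m] [/= Wgf nm]; rewrite /P -[g : L](subrK (f : L)) scalerDr; apply: WV.
    by apply: balW Wgf; exact: inv_exp2_le1.
  by apply: nW => //; rewrite modulus_exp2 ler_weXn2l ?ler1n.
by move=> n _ /(_ n (leqnn n)) nA; exists n => f /nA.
Qed.

Lemma mixed_cvg0_absorbed (u : nat -> L) :
  (u : nat -> Lmixed) @ \oo --> (0 : Lmixed) -> absorbed (range u).
Proof.
move=> u0 V /mixed_nbhs_halfP[W [W0 balW WV]].
have [N _ Nu] := u0 _ W0.
have [r ur] := finite_norm_bounded (finite_image u (finite_II N)).
have [n nW] := norm_absorbed r W0; exists n => _ [m _ <-].
have [mN|Nm] := ltnP m N; last first.
  rewrite -[_ *: _]addr0; apply: WV; last exact: (nbhs_singleton W0).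
  by apply: balW; [exact: inv_exp2_le1|exact: Nu].
rewrite -[_ *: _]addr0; apply: WV; last exact: (nbhs_singleton W0).
by apply: nW; [apply: ur; exists m|rewrite modulus_exp2].
Qed.

Lemma bounded_in_tvsP (A : set L) : bounded_in_tvs (A : set Lmixed) <->
  lip_bounded A.
Proof.
split=> [bA|[r Ar] U U0].
  apply: absorbed_norm_bounded => V /bA[r r0 rA].
  have [n rn] := exp2_bound (modulus r); exists n => f.
  have r2n : r <= `|2 ^+ n : K|.
    by rewrite -[r]gtr0_norm// -!ofreal_modulus modulus_exp2 ler_ofreal.
  move=> /(rA _ r2n)[v Vv <-].
  by rewrite scalerA mulVf ?scale1r// expf_neq0// pnatr_eq0.
have [n nU] := norm_absorbed r U0; exists (2 ^+ n); first by rewrite exprn_gt0.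
move=> a na f Af; have a0 : a != 0.
  by apply/eqP => a00; move: na; rewrite a00 normr0 lt_geF ?exprn_gt0.
exists (a^-1 *: f); last by rewrite scalerA divff ?scale1r.
apply: nU; first exact: Ar.
by rewrite -(@ler_ofreal _ k) -natrX ofreal_nat natrX ofreal_modulus.
Qed.

End Bounded.

(** * Norm balls in the compact-open topology *)

Section Balls.
Context {R : realType} {k : scalar_kind} {X : metricType R} {x0 : X}.
Local Notation K := (scalars R k).
Local Notation L := (lip0 k x0).
Local Notation Lco := (lip0_co k x0).
Local Notation Lmixed := (lip0_mixed k x0).

Lemma lip0B (f g : L) x : (f - g) x = f x - g x.
Proof. by []. Qed.

Lemma LipN (f : L) : Lip (- f) = Lip f.
Proof. by rewrite -scaleN1r LipZ modulusN modulus1 mul1r. Qed.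

Lemma LipB (f g : L) : Lip (f - g) <= Lip f + Lip g.
Proof. by rewrite (le_trans (LipD _ _))// LipN. Qed.

Lemma pointwise_limit_slope (r : R) (f : X -> K) :
  (forall (x y : X) (e : R), 0 < e -> exists g : L,
    [/\ Lip g <= r, modulus (f x - g x) < e & modulus (f y - g y) < e]) ->
  forall x y, modulus (f x - f y) <= r * mdist x y.
Proof.
move=> fg x y; apply/ler_addgt0Pr => e e0.
have e20 : 0 < e / 2 by rewrite divr_gt0.
have [g [gr gx gy]] := fg x y _ e20.
have -> : f x - f y = (f x - g x) + ((g x - g y) + - (f y - g y)) by ring.
have gxy : modulus (g x - g y) <= r * mdist x y.
  rewrite (le_trans (LipP (lip0_lipschitz g) x y))//.
  by rewrite ler_wpM2r ?mdist_ge0.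
have := ler_modulusD (f x - g x) ((g x - g y) + - (f y - g y)).
have := ler_modulusD (g x - g y) (- (f y - g y)).
by rewrite modulusN; lra.
Qed.

Lemma lipschitz_is_lip0 (f : X -> K) (r : R) : f x0 = 0 ->
  (forall x y, modulus (f x - f y) <= r * mdist x y) -> f \in is_lip0 x0.
Proof. by move=> f0 fr; rewrite inE; split=> //; exists r. Qed.

Lemma co_nbhs_point (f : L) (x : X) (e : R) : 0 < e ->
  nbhs (f : Lco) [set g : L | modulus (f x - g x) < e].
Proof.
move=> e0; apply/co_nbhsE; exists [set x], e; split => //.
  exact: compact_set1.
move=> g /(_ x erefl); rewrite -modulusN; congr (modulus _ < e).
by rewrite opprB.
Qed.

Lemma co_hausdorff : hausdorff_space Lco.
Proof.
move=> f g fg; apply: lip0_eqP => x; apply/subr0_eq/modulus_le0.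
apply/ler_addgt0Pr => e e0; rewrite add0r.
have e20 : 0 < e / 2 by rewrite divr_gt0.
have [h [/= fh gh]] := fg _ _ (co_nbhs_point f x e20) (co_nbhs_point g x e20).
rewrite -[(f : L) x](subrK ((h : L) x)) -addrA (le_trans (ler_modulusD _ _))//.
by rewrite [leRHS]splitr lerD// ltW// -modulusN opprB.
Qed.

Lemma ball_co_closed (r : R) : 0 <= r -> closed (lip0_ball r : set Lco).
Proof.
move=> r0 f fr; apply: Lip_le => //; apply: pointwise_limit_slope => x y e e0.
have [g [gr [gx gy]]] :=
  fr _ (filterI (co_nbhs_point f x e0) (co_nbhs_point f y e0)).
by exists g.
Qed.

(** A pointwise limit h along an ultrafilter on the ball exists because the
    values at x stay in a disc of radius r d(x, x0), and it belongs to the ball.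
    The convergence is uniform on compact sets because the ball is
    equicontinuous: near x, both f and h move by at most e / 3. *)
Lemma ball_co_compact (r : R) : 0 <= r -> compact (lip0_ball r : set Lco).
Proof.
move=> r0; rewrite compact_ultra => F FU Fr.
have /choice[h hP] : forall x, exists z : K,
    modulus z <= r * mdist x x0 /\ (fun f : L => f x) @ F --> z.
  move=> x; have [|z zr Fz] := ultra_cvg_image (f := fun f : L => f x) FU
    (@closed_disc_compact R k (r * mdist x x0)); last by exists z.
  apply: filterS Fr => f fr /=.
  have := LipP (lip0_lipschitz f) x x0; rewrite lip0_base subr0.
  by move=> /le_trans; apply; rewrite ler_wpM2r// mdist_ge0.
have Fh x (e : R) : 0 < e -> F [set f : L | modulus (h x - f x) < e].
  move=> e0; have [_ /(_ [set z | modulus (h x - z) < e])] := hP x; apply.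
  by apply/scalar_nbhsP; exists e.
have h_slope : forall x y, modulus (h x - h y) <= r * mdist x y.
  apply: pointwise_limit_slope => x y e e0.
  have [f [fr [fx fy]]] :=
    filter_ex (filterI Fr (filterI (Fh x e e0) (Fh y e e0))).
  by exists f.
have h0 : h x0 = 0.
  by apply: modulus_le0; have [+ _] := hP x0; rewrite mdistxx mulr0.
pose H : L := MkLip0 (lipschitz_is_lip0 h0 h_slope).
exists H; split; first exact: Lip_le.
move=> A /co_nbhsE[C [e [cC e0 eA]]].
have e30 : 0 < e / 3 by rewrite divr_gt0.
have d0 : 0 < e / 3 / (r + 1) by rewrite divr_gt0// ltr_wpDl.
move/compact_near_coveringP : cC.
move=> /(_ L F (fun (f : L) x => modulus (f x - h x) < e) _) cover.
have {cover} : F [set f : L | forall x, C x -> modulus (f x - h x) < e].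
  apply: cover => x Cx; exists (ball x (e / 3 / (r + 1)),
      [set f : L | Lip f <= r /\ modulus (h x - f x) < e / 3]).
    by split; [exact: nbhsx_ballx|exact: filterI Fr (Fh _ _ e30)].
  move=> [y f] /= [+ [fr fx]]; rewrite ballEmdist /= => xy.
  have rxy : r * mdist x y <= e / 3.
    rewrite (@le_trans _ _ ((r + 1) * mdist x y)) ?ler_wpM2r ?mdist_ge0 ?lerDl//.
    by rewrite mulrC -ler_pdivlMr ?ltW// ltr_wpDl.
  have fxy : modulus (f x - f y) <= e / 3.
    rewrite (le_trans (LipP (lip0_lipschitz f) x y))// (le_trans _ rxy)//.
    by rewrite ler_wpM2r ?mdist_ge0.
  have -> : f y - h y = - (f x - f y) + (- (h x - f x) + (h x - h y)).
    by ring.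
  have := ler_modulusD (- (f x - f y)) (- (h x - f x) + (h x - h y)).
  have := ler_modulusD (- (h x - f x)) (h x - h y).
  have := h_slope x y.
  rewrite !modulusN; lra.
apply: filterS => f fP; apply: eA => x Cx; exact: fP.
Qed.

End Balls.

(** * Comparison of the topologies *)

Section Comparison.
Context {R : realType} {k : scalar_kind} {X : metricType R} {x0 : X}.
Local Notation K := (scalars R k).
Local Notation L := (lip0 k x0).
Local Notation Lco := (lip0_co k x0).
Local Notation Lmixed := (lip0_mixed k x0).

Lemma nbhs_coarser (sigma tau : Topological L) :
  (forall (f : L) (A : set L), @nbhs _ (Topological.Pack sigma) f A ->
    @nbhs _ (Topological.Pack tau) f A) -> coarser sigma tau.
Proof.
move=> st O oO; rewrite openE => f Of.
by apply: st; exact: open_nbhs_nbhs.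
Qed.

Lemma mixed_nbhs_of_co (f : L) (A : set L) :
  nbhs (f : Lco) A -> nbhs (f : Lmixed) A.
Proof.
by move=> /co_nbhs_shift/co_nbhs_mixed; exact: (mixed_nbhs_shift f A).2.
Qed.

Lemma norm_nbhs_of_mixed (f : L) (A : set L) :
  nbhs (f : Lmixed) A -> nbhs (f : lip0_norm k x0) A.
Proof.
move=> [U /mixed_nbhd_norm[e e0 eU] UA]; apply/norm_nbhsE; exists e => // g ge.
by rewrite -[g](subrK f) addrC; apply/UA/eU.
Qed.

(** On the ball of radius r around 0 the increments from f have norm at most
    r + Lip f, so [mixed_nbhs_ball] applies to them. *)
Lemma co_nbhs_of_mixed (r : R) (f : L) (A : set L) : nbhs (f : Lmixed) A ->
  nbhs (f : Lco) [set g : L | Lip g <= r -> A g].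
Proof.
move=> /mixed_nbhs_shift/(mixed_nbhs_ball (r + Lip f)) A0.
apply/co_nbhs_shift; apply: filterS A0 => g; rewrite /mkset => gA fgr; apply: gA.
by rewrite -[g](addKr f) addrC (le_trans (LipB _ _))// lerD2r.
Qed.

Lemma coarser_co_mixed : coarser (tau_0 k x0) (tau_gamma k x0).
Proof. exact/nbhs_coarser/mixed_nbhs_of_co. Qed.

Lemma coarser_mixed_norm : coarser (tau_gamma k x0) (tau_Lip k x0).
Proof. exact/nbhs_coarser/norm_nbhs_of_mixed. Qed.

Lemma mixed_locally_convex : locally_convex_topology (tau_gamma k x0).
Proof.
split.
- exact: (@add_continuous Lmixed).
- exact: (@scale_continuous K Lmixed).
- exact: (@locally_convex K Lmixed).
Qed.

Lemma mixed_coincide (B : set L) : lip_bounded B ->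
  coincide_on (tau_gamma k x0) (tau_0 k x0) B.
Proof.
move=> [r rB]; apply/seteqP; split=> _ [W oW <-].
  (* the compact-open set that cuts out the trace of W on B *)
  exists (@interior Lco [set g : L | Lip g <= r -> W g]).
    exact: open_interior.
  apply/seteqP; split=> f [Of Bf]; split=> //.
    by have := interior_subset Of; apply; exact: rB.
  by apply: co_nbhs_of_mixed; exact: (@open_nbhs_nbhs Lmixed).
by exists W => //; exact: coarser_co_mixed.
Qed.

(** A convex neighborhood of 0 for tau satisfies [convex_mixed_nbhs]: dilations
    are tau-continuous, and tau agrees with the compact-open topology on the
    norm balls. *)
Lemma coarser_mixed_max (tau : Topological L) : locally_convex_topology tau ->
  (forall B : set L, lip_bounded B ->
     coincide_on tau (tau_0 k x0) B) ->
  coarser tau (tau_gamma k x0).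
Proof.
pose T : topologicalType := Topological.Pack tau.
move=> [addc scalec [Bs Bconv [Bopen Bbasis]]] coinc.
apply: nbhs_coarser => f A fA; apply/mixed_nbhs_shift.
have A0 : nbhs ((0 : L) : T) [set g : L | A (f + g)].
  have := addc ((f : T), ((0 : L) : T)) A; rewrite /= addr0 => /(_ fA).
  move=> [[P Q] /= [Pf Q0] PQA]; apply: filterS Q0 => g Qg.
  by apply: (PQA ((f : T), (g : T))); split => //; exact: (@nbhs_singleton T _ _ Pf).
have [b [Bb b0] bA] := Bbasis _ _ A0.
apply: (@filterS _ (nbhs (0 : Lmixed)) _ b) => [g bg|]; first exact: bA.
apply: convex_mixed_nbhs; first by apply: Bconv; rewrite inE.
move=> n.
have bn : nbhs ((0 : L) : T) [set g : L | b ((2 ^+ n.+1 : K) *: g)].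
  have := scalec ((2 ^+ n.+1 : K), ((0 : L) : T)) b; rewrite /= scaler0.
  have b0' : @nbhs _ T (0 : L) b by apply: open_nbhs_nbhs; split => //; exact: Bopen.
  move=> /(_ b0')[[P Q] /= [Pf Q0] PQb]; apply: filterS Q0 => g Qg.
  by apply: (PQb ((2 ^+ n.+1 : K), (g : T))); split => //; exact: (nbhs_singleton Pf).
pose O : set T := @interior T [set g : L | b ((2 ^+ n.+1 : K) *: g)].
have : [set U `&` lip0_ball (2 ^+ n) | U in @open T] (O `&` lip0_ball (2 ^+ n)).
  by exists O => //; exact: open_interior.
rewrite (coinc (lip0_ball (2 ^+ n))); last by exists (2 ^+ n).
move=> [U oU UO].
have /= U0 : nbhs (0 : Lco) U.
  apply: open_nbhs_nbhs; split => //.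
  have : (O `&` lip0_ball (2 ^+ n)) 0 by split => //; exact: lip0_ball0.
  by rewrite -UO => -[].
apply: filterS U0 => g Ug; rewrite /mkset => gn.
have : (U `&` lip0_ball (2 ^+ n)) g by [].
by rewrite UO => -[/interior_subset].
Qed.

(** The preimage of a convex neighborhood of 0 is convex, and continuity on the
    ball of radius 2^n, at 0 alone, is what [convex_mixed_nbhs] asks for. *)
Lemma mixed_continuousP (F : tvsType K) (T : {linear L -> F}) :
  continuous (T : Lmixed -> F) <->
  forall B : set L, lip_bounded B ->
    {within (B : set Lco), continuous (T : Lco -> F)}.
Proof.
split=> [Tc B [r rB]|Tc f A fA].
  apply/subspace_continuousP => f Bf A fA.
  have := co_nbhs_of_mixed r (Tc f A fA).
  rewrite /= /within; apply: filterS => g; rewrite /mkset => gA Bg.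
  by apply: gA; exact: rB.
apply/mixed_nbhs_shift.
have A0 : nbhs (0 : F) [set v | A (T f + v)].
  have := @add_continuous F (T f, 0) A; rewrite /= addr0 => /(_ fA).
  move=> [[P Q] /= [Pf Q0] PQA]; apply: filterS Q0 => v Qv.
  by apply: (PQA (T f, v)); split => //; exact: (nbhs_singleton Pf).
have [Bs Bconv [Bopen Bbasis]] := @locally_convex K F.
have [b [Bb b0] bA] := Bbasis _ _ A0.
apply: (@filterS _ (nbhs (0 : Lmixed)) _ (T @^-1` b)) => [g bg|].
  by rewrite /mkset /preimage /= linearD; exact: bA.
apply: convex_mixed_nbhs.
  move=> g h l; rewrite !inE => bg bh.
  have := Bconv b _ (T g) (T h) l.
  rewrite !inE => /(_ Bb bg bh).
  by rewrite /preimage /= linearD !linearZ.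
move=> n.
have bn : nbhs (0 : F) [set v : F | b ((2 ^+ n.+1 : K) *: v)].
  have := @scale_continuous K F (2 ^+ n.+1, 0) b; rewrite /= scaler0.
  have b0' : nbhs 0 b by apply: open_nbhs_nbhs; split => //; exact: Bopen.
  move=> /(_ b0')[[P Q] /= [Pf Q0] PQb]; apply: filterS Q0 => v Qv.
  by apply: (PQb (2 ^+ n.+1, v)); split => //; exact: (nbhs_singleton Pf).
have bounded_ball : lip_bounded (lip0_ball (2 ^+ n) : set L).
  by exists (2 ^+ n : R).
have /subspace_continuousP/(_ (0 : Lco) (lip0_ball0 _ _ n)) Tc0 :=
  Tc _ bounded_ball.
have bTn : nbhs (T 0) [set v : F | b ((2 ^+ n.+1 : K) *: v)] by rewrite linear0.
have : nbhs (0 : Lco)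
    [set g : L | lip0_ball (2 ^+ n) g -> b ((2 ^+ n.+1 : K) *: T g)] := Tc0 _ bTn.
by apply: filterS => g; rewrite /mkset /preimage /= linearZ.
Qed.

Lemma mixed_cvg0P (u : nat -> L) :
  ((u : nat -> Lmixed) @ \oo --> (0 : Lmixed)) <->
  lip_bounded (range u) /\
  ((u : nat -> Lco) @ \oo --> (0 : Lco)).
Proof.
split=> [u0|[[r ur] u0] A A0].
  split; first exact/absorbed_norm_bounded/mixed_cvg0_absorbed.
  by move=> A /mixed_nbhs_of_co; exact: u0.
have u0A : \oo [set n | Lip (u n) <= r -> A (u n)] := u0 _ (co_nbhs_of_mixed r A0).
suff : \oo [set n | A (u n)] by [].
by apply: filterS u0A => n; rewrite /mkset; apply; apply: ur; exists n.
Qed.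

Lemma mixed_compactP (A : set L) : compact (A : set Lmixed) <->
  lip_bounded A /\ compact (A : set Lco).
Proof.
split=> [cA|[[r rA] cA] F FF FA].
  split; first exact/absorbed_norm_bounded/mixed_compact_absorbed.
  move=> F FF FA; have [f [Af Ff]] := cA F FF FA; exists f; split => // P Q FP.
  by move=> /mixed_nbhs_of_co; exact: Ff.
have [f [Af Ff]] := cA F FF FA; exists f; split => // P Q FP Qf.
have [g [[Pg Ag] gQ]] := Ff _ _ (filterI FP FA) (co_nbhs_of_mixed r Qf).
by exists g; split => //; apply: gQ; exact: rA.
Qed.

Lemma mixed_precompactP (A : set L) : precompact (A : set Lmixed) <->
  lip_bounded A /\ precompact (A : set Lco).
Proof.
rewrite !precompactE; split.
  move=> /mixed_compactP[[r rA] cA]; split.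
    by exists r => f Af; apply: rA; exact: subset_closure.
  apply: (subclosed_compact _ cA); first exact: closed_closure.
  have /closure_id -> := compact_closed co_hausdorff cA.
  by apply: closureS; exact: (@subset_closure Lmixed).
move=> [[r rA] cA].
(* the maximum with 0 covers the case of a negative bound r, when A is empty *)
have rclA f : @closure Lco A f -> Lip f <= Num.max r 0.
  have r0 : 0 <= Num.max r 0 by rewrite le_max lexx orbT.
  move=> clf; apply: (ball_co_closed r0); apply: closureS clf => g /rA gr.
  by rewrite /lip0_ball /mkset le_max gr.
have mcA : compact (@closure Lco A : set Lmixed).
  by apply/mixed_compactP; split => //; exists (Num.max r 0).
apply: (subclosed_compact _ mcA); first exact: closed_closure.
by move=> f fA Q /mixed_nbhs_of_co; exact: fA.
Qed.

Lemma mixed_entourageP (E : set (Lmixed * Lmixed)) : entourage E <->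
  exists2 V : set L, nbhs (0 : Lmixed) V & forall f g : L, V (f - g) -> E (f, g).
Proof.
split=> [[V [V0 VE]]|[V V0 VE]].
  by exists V => // f g fg; have := VE (f, g); rewrite !inE; apply.
by exists V; split=> // -[f g]; rewrite !inE; exact: VE.
Qed.

(** The centers of a finite compact-open covering of A need not be close to A in
    norm.  They are replaced by points of A, at the price of halving the radius,
    so that the differences stay in a norm ball, where the compact-open and the
    mixed neighborhoods of 0 can be compared. *)
Lemma mixed_totally_boundedP (A : set L) :
  totally_bounded (A : set Lmixed) <->
  lip_bounded A /\ totally_bounded (A : set Lco).
Proof.
split=> [tbA|[[r rA] tbA] V /mixed_entourageP[W W0 WV]].
  split; first exact/absorbed_norm_bounded/mixed_totally_bounded_absorbed.
  move=> E /co_entourageP[C [e [cC e0 eE]]]; apply: tbA; apply/mixed_entourageP.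
  by exists (co_disk C e) => //; exact/co_nbhs_mixed/co_disk_nbhs.
have /co_nbhsE[C [e [cC e0 eW]]] := mixed_nbhs_ball (r + r) W0.
have e20 : 0 < e / 2 by rewrite divr_gt0.
have [|F finF AF] := tbA [set fg : L * L | co_disk C (e / 2) (fg.1 - fg.2)].
  by apply/co_entourageP; exists C, (e / 2).
pose near c f := A f /\ co_disk C (e / 2) (c - f).
have /choice[p pP] : forall c : L, exists f : L,
    (exists g, near c g) -> near c f.
  move=> c; have [[g cg]|no] := pselect (exists g, near c g); first by exists g.
  by exists 0.
exists (p @` F); first exact: finite_image.
move=> f Af; have [c Fc cf] := AF f Af; exists (p c); first by exists c.
have [Ap cp] := pP c (ex_intro _ f (conj Af cf)).
apply: WV; apply: eW; last first.
  by rewrite (le_trans (LipB _ _))// lerD// rA.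
rewrite subr0 => x Cx.
have -> : p c - f = (c - f) - (c - p c) by rewrite opprB [RHS]addrC addrA subrK.
rewrite [X in modulus X](_ : _ = (c - f) x + - (c - p c) x)//.
rewrite (le_lt_trans (ler_modulusD _ _))// modulusN [ltRHS]splitr.
by rewrite ltrD//; [exact: cf|exact: cp].
Qed.

Lemma mixed_semi_Montel : semi_Montel Lmixed.
Proof.
move=> A /bounded_in_tvsP[r rA]; apply/mixed_precompactP; split; first by exists r.
have r0 : 0 <= Num.max r 0 by rewrite le_max lexx orbT.
exists (lip0_ball (Num.max r 0)); last first.
  by split; [exact: ball_co_compact|exact: ball_co_closed].
by move=> f /rA fr; rewrite /lip0_ball /mkset le_max fr.
Qed.

End Comparison.

(** * Completeness *)

Section Completeness.
Context {R : realType} {k : scalar_kind} {X : metricType R} {x0 : X}.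
Local Notation K := (scalars R k).
Local Notation L := (lip0 k x0).
Local Notation Lco := (lip0_co k x0).
Local Notation Lmixed := (lip0_mixed k x0).

(** The sets 2^-n (U_0 `&` ... `&` U_n): a sequence below U in which the sum of
    two copies of a set is contained in the previous one, so that a sum of terms
    taken beyond index n stays in the n-th set. *)
Definition co_sequence_shrink (U : nat -> set L) : nat -> set L :=
  fun n => [set f | forall i, (i <= n)%N -> U i ((2 ^+ n : K) *: f)].

Lemma co_sequence_shrinkP U : co_sequence U -> co_sequence (co_sequence_shrink U).
Proof.
move=> cU n; split.
- have UI m : nbhs (0 : Lco) [set f : L | forall i, (i <= m)%N -> U i f].
    elim: m => [|m IH].
      have [U0 _ _] := cU 0%N; apply: filterS U0 => f.
      by rewrite /mkset => Uf [].
    have [Um _ _] := cU m.+1; apply: filterS2 IH Um => f.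
    rewrite /mkset => IH Uf i.
    by rewrite leq_eqVlt => /predU1P[->//|]; exact: IH.
  have := co_nbhs_scale (2 ^+ n) (UI n).
  by apply: filterS => f; rewrite /mkset.
- apply/convex_setP => a b f g a0 b0 ab Uf Ug i ni.
  have -> : (2 ^+ n : K) *: (a *: f + b *: g) =
      a *: ((2 ^+ n : K) *: f) + b *: ((2 ^+ n : K) *: g).
    by rewrite scalerDr !scalerA ![_ * 2 ^+ n]mulrC.
  have [_ /convex_setP Uc _] := cU i.
  by apply: Uc => //; [exact: Uf|exact: Ug].
- move=> a f a1 Uf i ni; rewrite scalerA mulrC -scalerA.
  by have [_ _] := cU i; apply => //; exact: Uf.
Qed.

Lemma convex_midpoint (A : set L) (f g : L) : convex_set A -> A f -> A g ->
  A (2^-1 *: (f + g)).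
Proof.
move=> /convex_setP cA Af Ag; rewrite scalerDr; apply: cA => //.
by rewrite -[LHS]mulr2n -[LHS]mulr_natl mulfV// pnatr_eq0.
Qed.

Lemma co_sequence_shrinkD U n (f g : L) : co_sequence U ->
  co_sequence_shrink U n.+1 f -> co_sequence_shrink U n.+1 g ->
  co_sequence_shrink U n (f + g).
Proof.
move=> cU Uf Ug i ni; have [_ Uc _] := cU i.
have -> : (2 ^+ n : K) *: (f + g) =
    2^-1 *: ((2 ^+ n.+1 : K) *: f + (2 ^+ n.+1 : K) *: g).
  by rewrite -scalerDr scalerA exprS mulKf// pnatr_eq0.
by apply: convex_midpoint => //; [apply: Uf|apply: Ug]; exact: leqW.
Qed.

Lemma co_sequence_shrinkS U n : co_sequence U -> co_sequence_shrink U n `<=` U n.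
Proof.
move=> cU f Uf; have [_ _ Ub] := cU n.
have -> : f = (2 ^+ n : K)^-1 *: ((2 ^+ n : K) *: f).
  by rewrite scalerA mulVf ?scale1r// expf_neq0// pnatr_eq0.
by apply: Ub; [exact: inv_exp2_le1|exact: Uf].
Qed.

Lemma co_sequence_shrink_sum U n m (g : nat -> L) : co_sequence U ->
  (forall i, co_sequence_shrink U i (g i)) ->
  co_sequence_shrink U n (\sum_(i < m) g (n.+1 + i)%N).
Proof.
move=> cU gU; elim: m n => [|m IH] n.
  rewrite big_ord0; have [+ _ _] := co_sequence_shrinkP cU n.
  exact: nbhs_singleton.
rewrite big_ord_recl addn0; apply: co_sequence_shrinkD => //.
under eq_bigr => i _ do rewrite /= /bump /= add1n addnS -addSn.
exact: IH.
Qed.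

Lemma Lip_sum_exp2 (g : nat -> L) n : (forall i, Lip (g i) <= 2 ^+ i) ->
  Lip (\sum_(i < n) g i) <= 2 ^+ n.
Proof.
move=> gi; elim: n => [|n IH]; first by rewrite big_ord0 Lip0.
rewrite big_ord_recr /= (le_trans (LipD _ _))// exprS mulr_natl mulr2n.
by rewrite lerD.
Qed.

(** [W] is a mixed neighborhood of 0 whose compact-open closure lies in [V].  Let
    f be in the closure of the neighborhood given by the shrunken sequence T,
    choose n with Lip f <= 2^n, and g0 in this neighborhood with f - g0 in T_n.
    Cut the sum defining g0 after index n, with head s.  The head is a genuine
    element of the neighborhood.  The rest f - s is the tail plus f - g0, which
    is a sum of two elements of T_n, and its norm is at most
    Lip f + Lip s <= 2^n + 2^(n+1) although nothing bounds the norm of the tail: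
    (f - s) / 4 is in T_n and in the ball of radius 2^n.  So f / 8 is in the
    neighborhood, which is chosen with the factor 8 to spare. *)
Lemma mixed_nbhs_co_closed (V : set L) : nbhs (0 : Lmixed) V ->
  exists2 W : set L, nbhs (0 : Lmixed) W & forall f : L,
    (forall N : set L, nbhs (0 : Lco) N -> exists2 g, W g & N (f - g)) -> V f.
Proof.
move=> /mixed_nbhs0P[U cU UV]; have [U' cU' U'U] := mixed_nbhd_iter 3 cU.
pose T := co_sequence_shrink U'.
have cT : co_sequence T := co_sequence_shrinkP cU'.
exists (mixed_nbhd T); first by apply/mixed_nbhs0P; exists T.
move=> f fT; have [n fn] := exp2_bound (Lip f).
have [Tn Tconv Tbal] := cT n.
have [g0 /(mixed_nbhd_pad cT)[M gM] fg] := fT _ Tn.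
have [g gT g0E] := gM _ (leq_addl n.+1 M).
pose s : L := \sum_(i < n.+1) g i.
have sT : mixed_nbhd T s by exists n => //; exists g => // i _.
have fs : f - s = \sum_(i < M) g (n.+1 + i)%N + (f - g0).
  by rewrite g0E big_split_ord /= -/s opprD [RHS]addrC addrA subrK.
have tailT : T n (\sum_(i < M) g (n.+1 + i)%N).
  by apply: co_sequence_shrink_sum => // i; have [] := gT i.
have fs4 : mixed_nbhd T (2^-1 *: (2^-1 *: (f - s))).
  apply: (@mixed_nbhd_single _ _ _ _ _ n) => //.
    rewrite fs; apply: Tbal; last exact: (convex_midpoint Tconv tailT fg).
    by rewrite ger0_norm ?invr_ge0// invf_le1// ler1n.
  have fsn : Lip (f - s) <= 2 ^+ n + 2 ^+ n.+1.
    rewrite (le_trans (LipB _ _))// lerD//.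
    by apply: Lip_sum_exp2 => i; have [] := gT i.
  rewrite !LipZ modulusV (modulus_nat 2); move: fsn; rewrite exprS.
  have : 0 <= 2 ^+ n :> R by rewrite exprn_ge0.
  lra.
have s4 : mixed_nbhd T (2^-1 *: (2^-1 *: s)).
  have half1 : `|2^-1 : K| <= 1.
    by rewrite ger0_norm ?invr_ge0// invf_le1// ler1n.
  by do 2 apply: mixed_nbhd_bal => //.
have f8 : mixed_nbhd T (2^-1 *: (2^-1 *: (2^-1 *: f))).
  have -> : f = s + (f - s) by rewrite addrC subrK.
  rewrite ![2^-1 *: (s + _)]scalerDr [2^-1 *: (_ + _)]scalerDr.
  by apply: convex_midpoint => //; exact: mixed_nbhd_conv.
have -> : f = (2 ^+ 3 : K) *: (2^-1 *: (2^-1 *: (2^-1 *: f))).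
  have double (v : L) : (2 : K) *: (2^-1 *: v) = v.
    by rewrite scalerA mulfV ?scale1r// pnatr_eq0.
  by rewrite !exprS expr0 mulr1 -!scalerA !double.
apply/UV/U'U; apply: mixed_nbhdS f8 => i; exact: co_sequence_shrinkS.
Qed.

Lemma cauchy_mixed_small (G : set_system L) {FG : Filter G} :
  cauchy (G : set_system Lmixed) -> forall V : set L, nbhs (0 : Lmixed) V ->
  exists2 S, G S & forall f g, S f -> S g -> V (f - g).
Proof.
move=> cG V V0.
have entV : entourage [set fg : Lmixed * Lmixed | V ((fg.1 : L) - fg.2)].
  by apply/mixed_entourageP; exists V.
have [[P Q] /= [GP GQ] PQV] := cG _ entV.
exists (P `&` Q); first exact: filterI.
by move=> f g [Pf _] [_ Qg]; exact: (PQV (f, g)).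
Qed.

(** A Cauchy filter need not contain a bounded set, so the compactness of balls
    is of no help here.  If the pointwise limit h had slopes larger than 4^n
    along pairs (x n, y n), compare it with a fixed member f0 of a set of the
    filter that is small for [slope_mixed_nbhs]: the n-th slope of h is at most
    2^n + Lip f0, which is less than 4^n for large n. *)
Lemma mixed_cauchy_cvg (G : set_system L) : ProperFilter G ->
  cauchy (G : set_system Lmixed) ->
  exists f : L, (G : set_system Lmixed) --> (f : Lmixed).
Proof.
move=> PG cG.
have small := @cauchy_mixed_small G PG cG.
have /choice[h hP] : forall x, exists z : K, forall e : R, 0 < e ->
    G [set f : L | modulus (z - f x) < e].
  move=> x; have cx := @compact_set1 X x.
  have smallx (e : R) : 0 < e -> exists2 S, G S & forall f g : L, S f -> S g ->
      modulus (f x - g x) < e.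
    move=> e0; have [S GS SV] := small _ (co_nbhs_mixed (co_disk_nbhs cx e0)).
    by exists S => // f g Sf Sg; exact: (SV f g Sf Sg x erefl).
  have [S GS S1] := smallx 1 ltr01; have [f0 Sf0] := filter_ex GS.
  have Gdisc : G [set f : L | modulus (f x) <= modulus (f0 x) + 1].
    apply: filterS GS => f Sf; rewrite /mkset -[X in modulus X](subrK (f0 x)).
    by rewrite (le_trans (ler_modulusD _ _))// addrC lerD2l ltW// S1.
  have [z [_ zG]] := @closed_disc_compact R k _ ((fun f : L => f x) @ G) _ Gdisc.
  exists z => e e0; have e20 : 0 < e / 2 by rewrite divr_gt0.
  have [S' GS' Se] := smallx _ e20.
  have ze : nbhs z [set w | modulus (z - w) < e / 2].
    by apply/scalar_nbhsP; exists (e / 2).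
  have GS'x : G [set f : L | ((fun f : L => f x) @` S') (f x)].
    by apply: filterS GS' => f S'f; exists f.
  have [_ [[f1 S'f1 <-] zf1]] := zG _ _ GS'x ze.
  apply: filterS GS' => f S'f; rewrite /mkset.
  have -> : z - f x = (z - f1 x) + (f1 x - f x) by ring.
  rewrite (le_lt_trans (ler_modulusD _ _))// [ltRHS]splitr ltrD//.
  exact: Se.
have h0 : h x0 = 0.
  apply/modulus_le0/ler_addgt0Pr => e /hP-/(_ x0)/filter_ex[f].
  by rewrite /mkset lip0_base subr0 add0r => /ltW.
have h_slope x y c (S : set L) : G S ->
    (forall f, S f -> modulus (f x - f y) <= c) ->
    modulus (h x - h y) <= c.
  move=> GS Sc; apply/ler_addgt0Pr => e e0.
  have e20 : 0 < e / 2 by rewrite divr_gt0.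
  have [f [Sf [fx fy]]] :=
    filter_ex (filterI GS (filterI (hP x _ e20) (hP y _ e20))).
  have -> : h x - h y = (h x - f x) + ((f x - f y) + - (h y - f y)) by ring.
  move: fx fy; rewrite /mkset.
  have := ler_modulusD (h x - f x) ((f x - f y) + - (h y - f y)).
  have := ler_modulusD (f x - f y) (- (h y - f y)).
  have := Sc f Sf.
  rewrite modulusN; lra.
have [r hr] : exists r : R, forall x y, modulus (h x - h y) <= r * mdist x y.
  apply: contrapT => /forallNP steep.
  have /choice[p pP] : forall n, exists p : X * X,
      4 ^+ n * mdist p.1 p.2 < modulus (h p.1 - h p.2).
    move=> n; have /existsNP[x /existsNP[y /negP xy]] := steep (4 ^+ n).
    by exists (x, y); rewrite ltNge.
  have pne n : (p n).1 != (p n).2.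
    apply/eqP => pE; have := pP n.
    by rewrite pE subrr modulus0 ltNge mulr_ge0// ?exprn_ge0// mdist_ge0.
  have [S GS SV] := small _ (slope_mixed_nbhs pne).
  have [f0 Sf0] := filter_ex GS; have [m fm] := exp2_bound (Lip f0).
  set x := (p m.+1).1; set y := (p m.+1).2.
  have : modulus (h x - h y) <= (2 ^+ m.+1 + 2 ^+ m) * mdist x y.
    apply: (h_slope _ _ _ S) => // f Sf.
    have -> : f x - f y = ((f - f0) x - (f - f0) y) + (f0 x - f0 y).
      by rewrite !lip0B; ring.
    rewrite (le_trans (ler_modulusD _ _))// mulrDl lerD//.
      exact: (SV f f0 Sf Sf0 m.+1).
    rewrite (le_trans (LipP (lip0_lipschitz _) _ _))//.
    by rewrite ler_wpM2r ?mdist_ge0.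
  apply/negP; rewrite -ltNge (le_lt_trans _ (pP m.+1))// ler_wpM2r ?mdist_ge0//.
  rewrite !exprS; have m1 : 1 <= 2 ^+ m :> R by rewrite exprn_ege1// ler1n.
  have -> : 4 ^+ m = 2 ^+ m * 2 ^+ m :> R by rewrite -exprMn -natrM.
  nra.
pose H : L := MkLip0 (lipschitz_is_lip0 h0 hr).
exists H => A /mixed_nbhs_shift/mixed_nbhs_co_closed[W W0 WA].
have [S GS SW] := small _ W0.
apply: filterS (GS) => f Sf.
have -> : f = H + (f - H) :> L by rewrite addrC subrK.
(* f - H is approximated by f - g, small for f and g in S, where g is close to H
   on a compact set *)
apply: WA => N /co_nbhsE[C [e [cC e0 eN]]].
have e20 : 0 < e / 2 by rewrite divr_gt0.
have [S' GS' S'e] := small _ (co_nbhs_mixed (co_disk_nbhs cC e20)).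
have /= [g [Sg S'g]] := filter_ex (filterI GS GS').
exists (f - g); first exact: SW.
apply: eN; rewrite subr0 => x Cx.
have [g' [S'g' xg']] := filter_ex (filterI GS' (hP x _ e20)).
have -> : (f - H - (f - g)) x = (g - g') x + - (h x - g' x).
  by rewrite !lip0B /=; ring.
rewrite (le_lt_trans (ler_modulusD _ _))// modulusN [ltRHS]splitr ltrD//.
exact: S'e.
Qed.

End Completeness.

Theorem theorem2p1 (R : realType) (k : scalar_kind) (X : metricType R) (x0 : X) :
  (* (i) *)
  (coarser (tau_0 k x0) (tau_gamma k x0) /\
   coarser (tau_gamma k x0) (tau_Lip k x0)) /\
  (* (ii) *)
  ((locally_convex_topology (tau_gamma k x0) /\
    forall B : set (lip0 k x0), bounded_set (B : set (lip0_norm k x0)) ->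
      coincide_on (tau_gamma k x0) (tau_0 k x0) B) /\
   forall tau : Topological (lip0 k x0),
     locally_convex_topology tau ->
     (forall B : set (lip0 k x0), bounded_set (B : set (lip0_norm k x0)) ->
        coincide_on tau (tau_0 k x0) B) ->
     coarser tau (tau_gamma k x0)) /\
  (* (iii) *)
  (forall (F : tvsType (scalars R k)) (T : {linear lip0 k x0 -> F}),
     continuous (T : lip0_mixed k x0 -> F) <->
     forall B : set (lip0 k x0), bounded_set (B : set (lip0_norm k x0)) ->
       {within (B : set (lip0_co k x0)),
         continuous (T : lip0_co k x0 -> F)}) /\
  (* (iv) *)
  (forall u : nat -> lip0 k x0,
     ((u : nat -> lip0_mixed k x0) @ \oo --> (0 : lip0_mixed k x0)) <->
     bounded_set (range u : set (lip0_norm k x0)) /\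
     ((u : nat -> lip0_co k x0) @ \oo --> (0 : lip0_co k x0))) /\
  (* (v) *)
  (forall A : set (lip0 k x0),
     bounded_in_tvs (A : set (lip0_mixed k x0)) <-> bounded_set (A : set (lip0_norm k x0))) /\
  (* (vi) *)
  (forall A : set (lip0 k x0),
     [/\ compact (A : set (lip0_mixed k x0)) <->
         bounded_set (A : set (lip0_norm k x0)) /\ compact (A : set (lip0_co k x0)),
         totally_bounded (A : set (lip0_mixed k x0)) <->
         bounded_set (A : set (lip0_norm k x0)) /\ totally_bounded (A : set (lip0_co k x0)) &
         precompact (A : set (lip0_mixed k x0)) <->
         bounded_set (A : set (lip0_norm k x0)) /\ precompact (A : set (lip0_co k x0))]) /\
  (* (vii) *)
  (complete_space (lip0_mixed k x0) /\ semi_Montel (lip0_mixed k x0)).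
Proof.
split; first by split; [exact: coarser_co_mixed|exact: coarser_mixed_norm].
split.
  split; first split.
  - exact: mixed_locally_convex.
  - by move=> B /norm_boundedP; exact: mixed_coincide.
  - move=> tau tau_lc coinc; apply: coarser_mixed_max => // B /norm_boundedP.
    exact: coinc.
split.
  move=> F T; split=> [/mixed_continuousP Tc B /norm_boundedP|Tc]; first exact: Tc.
  by apply/mixed_continuousP => B /norm_boundedP; exact: Tc.
split.
  move=> u; split=> [/mixed_cvg0P[/norm_boundedP]//|[/norm_boundedP ur u0]].
  exact/mixed_cvg0P.
split.
  by move=> A; split=> [/bounded_in_tvsP/norm_boundedP|/norm_boundedP/bounded_in_tvsP].
split.
  move=> A; split.
  - split=> [/mixed_compactP[/norm_boundedP]//|[/norm_boundedP Ar cA]].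
    exact/mixed_compactP.
  - split=> [/mixed_totally_boundedP[/norm_boundedP]//|[/norm_boundedP Ar tA]].
    exact/mixed_totally_boundedP.
  - split=> [/mixed_precompactP[/norm_boundedP]//|[/norm_boundedP Ar pA]].
    exact/mixed_precompactP.
split; last exact: mixed_semi_Montel.
by move=> G; exact: mixed_cauchy_cvg.
Qed.
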